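(* Let $\Bbbk$ be a field, let $\lambda=(\lambda_1,\ldots,\lambda_n)$ be a partition with $\lambda_1\ge\cdots\ge\lambda_n\ge 1$ and $m=\lambda_1$, and let $Y$ be an arbitrary filling of the Young diagram of $\lambda$ by positive integers, with value $w(i,j)$ in box $(i,j)$ ($1\le i\le n$, $1\le j\le\lambda_i$). Let $S=\Bbbk[x_1,\ldots,x_n,y_1,\ldots,y_m]$ and $I(Y)=\big((x_iy_j)^{w(i,j)}\mid 1\le i\le n,\ 1\le j\le\lambda_i\big)$. Let $(\gamma,\delta)$ be a minimal box of $Y$. Then $$\operatorname{depth} S/I(Y)=\min\{\operatorname{depth} S/(I(Y)+(x_\gamma)),\ \operatorname{depth} S/(I(Y)+(y_\delta))\}.$$
   Context: $S$ is a standard graded polynomial ring. Let $\omega=\min\{w(i,j)\mid 1\le i\le n,1\le j\le\lambda_i\}$. A box $(\gamma,\delta)$ of the diagram is a minimal box of $Y$ if $w(\gamma,\delta)=\omega$ and $w(i,j)>\omega$ for every box $(i,j)\neq(\gamma,\delta)$ with $i\le\gamma$ and $j\le\delta$. *)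

(* Defs.v *)
From mathcomp Require Import all_boot all_algebra.
From mathcomp Require Import mpoly.

Set Implicit Arguments.
Unset Strict Implicit.
Unset Printing Implicit Defensive.

Import GRing.Theory.
Local Open Scope ring_scope.

Section Depth.
Variables (R : fieldType) (N : nat).
Local Notation P := {mpoly R[N]}.

Definition in_ideal (gs : seq P) (p : P) : Prop :=
  exists cs : seq P, p = \sum_(i < size gs) cs`_i * gs`_i.

Definition in_max_ideal (p : P) : Prop := p@_(0%MM) = 0.

Definition nzd_mod (gs : seq P) (f : P) : Prop :=
  forall g : P, in_ideal gs (f * g) -> in_ideal gs g.

Fixpoint is_regular_seq (gs : seq P) (fs : seq P) : Prop :=
  match fs with
  | [::] => ~ in_ideal gs 1
  | f :: fs' => [/\ in_max_ideal f, nzd_mod gs f & is_regular_seq (rcons gs f) fs']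
  end.

Definition is_depth (gs : seq P) (d : nat) : Prop :=
  (exists fs : seq P, size fs = d /\ is_regular_seq gs fs) /\
  (forall fs : seq P, is_regular_seq gs fs -> (size fs <= d)%N).

Definition mvar (k : nat) : P :=
  if (insub k : option 'I_N) is Some i then 'X_i else 0.

End Depth.

Definition is_box (lam : seq nat) (i j : nat) : bool :=
  (i < size lam)%N && (j < nth 0%N lam i)%N.

Definition is_partition (lam : seq nat) : bool :=
  sorted geq lam && all (fun l => 0 < l)%N lam.

Definition positive_filling (lam : seq nat) (w : nat -> nat -> nat) : Prop :=
  forall i j, is_box lam i j -> (0 < w i j)%N.

Definition minimal_box (lam : seq nat) (w : nat -> nat -> nat) (g d : nat) : Prop :=
  [/\ is_box lam g d,
      (forall i j, is_box lam i j -> (w g d <= w i j)%N) &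
      (forall i j, is_box lam i j -> (i <= g)%N -> (j <= d)%N -> (i, j) <> (g, d) ->
                   (w g d < w i j)%N)].

Definition nvars (lam : seq nat) : nat := (size lam + head 0 lam)%N.

Definition xv (R : fieldType) (lam : seq nat) (i : nat) : {mpoly R[nvars lam]} :=
  mvar R (nvars lam) i.
Definition yv (R : fieldType) (lam : seq nat) (j : nat) : {mpoly R[nvars lam]} :=
  mvar R (nvars lam) (size lam + j).

Definition IY (R : fieldType) (lam : seq nat) (w : nat -> nat -> nat)
  : seq {mpoly R[nvars lam]} :=
  flatten [seq [seq (xv R lam i * yv R lam j) ^+ w i j | j <- iota 0 (nth 0%N lam i)]
          | i <- iota 0 (size lam)].

(* Main.v *)
(* With [x = x_g], [y = y_d] and [om] the minimal weight, [(I + y^om) : x^om = I : x^om], and adjoining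
   [x^om] or [x] to [I] gives the same depth (likewise for [y]).  As the depth of a monomial ideal does
   not drop under colon by a monomial, the depth lemma for [x^om] yields the inequality [>=].

   For [<=], consider [I : f] for monomials [f = x^a y^b].  Its radical is the edge ideal of the Ferrers
   graph on the alive rows and columns, plus the other variables.  Adding the alive variables beyond a
   corner of that graph leaves an ideal with disconnected punctured spectrum, of depth at most 1; since
   adding a variable to a monomial ideal lowers the depth by at most 1, each corner gives an upper bound
   for the depth.  Induction using [>=] at a minimal box shows that these bounds are sharp, once we know
   that every corner bound for the diagram with a row (or column) of a minimal box deleted dominates one
   for the whole diagram; this last step is combinatorial.

   Depth is handled without homology: a maximal regular sequence may be started with any nonzerodivisor,
   and prime avoidance supplies one element that is a nonzerodivisor modulo several ideals at once. *)

From HB Require Import structures.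
Require Import Defs.
From mathcomp Require Import all_boot all_order all_algebra.
From mathcomp Require Import mpoly.
From mathcomp Require Import ring zify.
From Stdlib Require Import Classical ClassicalEpsilon FunctionalExtensionality PropExtensionality.

Set Implicit Arguments.
Unset Strict Implicit.
Unset Printing Implicit Defensive.

Import Order.LTheory GRing.Theory.
Local Open Scope ring_scope.

Lemma pred_ext (T : Type) (P Q : T -> Prop) : (forall x, P x <-> Q x) -> P = Q.
Proof. by move=> H; apply: functional_extensionality => x; apply: propositional_extensionality. Qed.

(** * Depth of cyclic modules over a Noetherian ring *)

Section Ideals.
Variable A : comNzRingType.
Implicit Types (J : A -> Prop) (f g h u : A).

Record is_ideal J : Prop := IsIdeal {
  ideal0 : J 0;
  idealD : forall p q, J p -> J q -> J (p + q);
  idealM : forall c p, J p -> J (c * p) }.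

Lemma idealN J p : is_ideal J -> J p -> J (- p).
Proof. by move=> IJ Jp; rewrite -mulN1r; apply: idealM. Qed.

Lemma idealB J p q : is_ideal J -> J p -> J q -> J (p - q).
Proof. by move=> IJ Jp Jq; apply: idealD => //; apply: idealN. Qed.

Lemma ideal_mulr J c p : is_ideal J -> J p -> J (p * c).
Proof. by move=> IJ Jp; rewrite mulrC; apply: idealM. Qed.

Lemma ideal_sum J (I : Type) (r : seq I) (P : pred I) (F : I -> A) :
  is_ideal J -> (forall i, P i -> J (F i)) -> J (\sum_(i <- r | P i) F i).
Proof.
move=> IJ HF; elim/big_ind: _ => //; first exact: ideal0.
by move=> *; apply: idealD.
Qed.

Lemma ideal_eqmod J p q : is_ideal J -> J (p - q) -> J q -> J p.
Proof. by move=> IJ Jpq Jq; rewrite -(subrK q p); apply: idealD. Qed.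

Definition adjoin J f : A -> Prop := fun p => exists c, J (p - c * f).
Definition colon J f : A -> Prop := fun p => J (p * f).
Definition nzd J f := forall g, J (f * g) -> J g.

Lemma adjoin_ideal J f : is_ideal J -> is_ideal (adjoin J f).
Proof.
move=> IJ; split.
- by exists 0; rewrite mul0r subrr; apply: ideal0.
- move=> p q [c Hc] [d Hd]; exists (c + d).
  by rewrite (_ : _ - _ = (p - c * f) + (q - d * f)); [apply: idealD|ring].
- move=> c p [d Hd]; exists (c * d).
  by rewrite (_ : _ - _ = c * (p - d * f)); [apply: idealM|ring].
Qed.

Lemma colon_ideal J f : is_ideal J -> is_ideal (colon J f).
Proof.
move=> IJ; split; rewrite /colon.
- by rewrite mul0r; apply: ideal0.
- by move=> p q Hp Hq; rewrite mulrDl; apply: idealD.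
- by move=> c p Hp; rewrite -mulrA; apply: idealM.
Qed.

Lemma sub_adjoin J f p : J p -> adjoin J f p.
Proof. by exists 0; rewrite mul0r subr0. Qed.

Lemma mem_adjoin J f c : is_ideal J -> adjoin J f (c * f).
Proof. by move=> IJ; exists c; rewrite subrr; apply: ideal0. Qed.

Lemma adjoinC J f g : adjoin (adjoin J f) g = adjoin (adjoin J g) f.
Proof.
by apply: pred_ext => p; split=> -[c [d Hd]]; exists d; exists c; rewrite addrAC.
Qed.

Lemma nzdX J f k : nzd J f -> nzd J (f ^+ k).
Proof.
move=> Hf; elim: k => [|k IH] g; first by rewrite expr0 mul1r.
by rewrite exprS -mulrA => /Hf /IH.
Qed.

Lemma nzd_colon J f h : nzd J h -> nzd (colon J f) h.
Proof. by move=> Hh g; rewrite /colon -mulrA => /Hh. Qed.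

(** If [f * u = v * g] modulo [J], then [v = t * f] for some [t]; cancelling [f] gives
    [u = t * g]. *)
Lemma nzd_swap J f g : is_ideal J -> nzd J f -> nzd J g -> nzd (adjoin J f) g ->
  nzd (adjoin J g) f.
Proof.
move=> IJ Hf Hg Hfg u [v Hv].
have [t Ht] : adjoin J f v.
  apply: Hfg; exists u; rewrite (_ : _ - _ = - (f * u - v * g)); last by ring.
  exact: idealN.
exists t; apply: Hf.
rewrite (_ : _ * _ = (f * u - v * g) + g * (v - t * f)); last by ring.
by apply: idealD => //; apply: idealM.
Qed.

(** Reduction modulo [g] keeps [0 -> A/(J : f) -> A/J -> A/(J + f) -> 0] exact: [u * f = v * g]
    forces [v = t * f], whence [u - t * g] lies in [J : f]. *)
Lemma colon_adjoin J f g : is_ideal J -> nzd (adjoin J f) g ->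
  colon (adjoin J g) f = adjoin (colon J f) g.
Proof.
move=> IJ Hg; apply: pred_ext => u; split=> [[v Hv]|[v Hv]]; last first.
  by exists (v * f); rewrite (_ : _ - _ = (u - v * g) * f); [|ring].
have [t Ht] : adjoin J f v.
  apply: Hg; exists u; rewrite (_ : _ - _ = - (u * f - v * g)); last by ring.
  exact: idealN.
exists t; rewrite /colon.
rewrite (_ : _ * _ = (u * f - v * g) + g * (v - t * f)); last by ring.
by apply: idealD => //; apply: idealM.
Qed.

Section Depth.
Variable m : A -> Prop.
Hypothesis mI : is_ideal m.

(* [J] is not assumed proper: the unit ideal satisfies [depth_ge k] for all [k]. *)
Fixpoint depth_ge (k : nat) J : Prop :=
  if k is k'.+1 then exists f, [/\ m f, nzd J f & depth_ge k' (adjoin J f)] else True.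

(** Positive depth without homology: over a Noetherian ring it is equivalent to [m] containing a
    nonzerodivisor modulo [J], by [nzd_socle_free] and [common_nzd]. *)
Definition socle_free J := forall u, (forall a, m a -> J (a * u)) -> J u.

Lemma depth_geW k l J : (l <= k)%N -> depth_ge k J -> depth_ge l J.
Proof.
elim: k l J => [|k IH] [|l] J //= lk [f [mf fJ Hk]].
by exists f; split=> //; apply: IH Hk.
Qed.

Lemma nzd_socle_free J f : m f -> nzd J f -> socle_free J.
Proof. by move=> mf Hf u Hu; apply/Hf/Hu. Qed.

Lemma depth_socle_free k J : depth_ge k.+1 J -> socle_free J.
Proof. by case=> f [mf Hf _]; apply: nzd_socle_free Hf. Qed.

(** If [m] kills [u] modulo [J + (g)] and [f * u = v * g], then [m] kills [v] modulo [J + (f)]. For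
    [f] and [g] in [m], both socles compute Ext^1(A/m, A/J). *)
Lemma socle_free_swap J f g : is_ideal J -> m f -> nzd J f -> nzd J g ->
  socle_free (adjoin J f) -> socle_free (adjoin J g).
Proof.
move=> IJ mf Hf Hg Hs u Hu.
have [v Hv] := Hu f mf.
have [s Hsv] : adjoin J f v.
  apply: Hs => a ma; have [t Ht] := Hu a ma; exists t; apply: Hg.
  rewrite (_ : _ * _ = f * (a * u - t * g) - a * (f * u - v * g)); last by ring.
  by apply: idealB => //; apply: idealM.
exists s; apply: Hf.
rewrite (_ : _ * _ = (f * u - v * g) + g * (v - s * f)); last by ring.
by apply: idealD => //; apply: idealM.
Qed.

(** * Noetherian rings: associated primes and prime avoidance *)

Definition noetherian := forall F : (A -> Prop) -> Prop,
  (exists J, is_ideal J /\ F J) ->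
  exists J, [/\ is_ideal J, F J &
    forall J', is_ideal J' -> F J' -> (forall p, J p -> J' p) -> forall p, J' p -> J p].

Hypothesis noethA : noetherian.

Lemma noetherian_ind (P : (A -> Prop) -> Prop) :
  (forall J, is_ideal J ->
    (forall J', is_ideal J' -> (forall p, J p -> J' p) -> (exists p, J' p /\ ~ J p) -> P J') ->
    P J) ->
  forall J, is_ideal J -> P J.
Proof.
move=> step J IJ; apply: NNPP => nPJ.
have [|K [IK nPK Kmax]] := noethA (F := fun K => ~ P K); first by exists J.
apply: nPK; apply: step => // K' IK' KK' [p [K'p nKp]]; apply: NNPP => nPK'.
by apply: nKp; apply: Kmax K'p.
Qed.

Definition is_prime (Q : A -> Prop) := ~ Q 1 /\ forall a b, Q (a * b) -> Q a \/ Q b.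
Definition assoc J Q := (exists u, Q = colon J u) /\ is_prime Q.

(** Among the ideals [J : v] with [v] outside [J] that contain [f], a maximal one is prime: if
    [a * b * v] is in [J] but [b * v] is not, then [J : (b * v)] is no larger than [J : v], yet
    contains [a]. *)
Lemma zero_divisor_assoc J f u : is_ideal J -> J (f * u) -> ~ J u ->
  exists Q, assoc J Q /\ Q f.
Proof.
move=> IJ Jfu nJu.
have [|K [IK [v [nJv -> Kf]] Kmax]] :=
  noethA (F := fun K => exists v, [/\ ~ J v, K = colon J v & K f]).
  by exists (colon J u); split; [exact: colon_ideal|exists u].
exists (colon J v); split=> //; split; first by exists v.
split; first by rewrite /colon mul1r.
move=> a b Jabv; case: (classic (colon J v b)) => [|nJbv]; first by right.
left; apply: (Kmax (colon J (b * v))).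
- exact: colon_ideal.
- by exists (b * v); split=> //; rewrite /colon mulrCA; apply: idealM.
- by move=> p Jpv; rewrite /colon mulrCA; apply: idealM.
- by rewrite /colon mulrA.
Qed.

(** Noetherian induction: given one associated prime [J : u], every other one is associated to
    [J + (u)]. *)
Lemma assoc_finite J : is_ideal J -> exists l, forall Q, assoc J Q -> List.In Q l.
Proof.
move: J; apply: noetherian_ind => J IJ IH.
case: (classic (J 1)) => [J1|nJ1].
  exists [::] => Q [[u ->] [[]]]; rewrite /colon mul1r -[u]mulr1.
  exact: idealM.
have [|P [[[u ->] [P1 Pprime]] _]] := @zero_divisor_assoc J 0 1 IJ _ nJ1.
  by rewrite mul0r; apply: ideal0.
have nJu : ~ J u by move=> Ju; apply: P1; rewrite /colon mul1r.
have [||l Hl] := IH (adjoin J u) (adjoin_ideal u IJ).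
- by move=> p; apply: sub_adjoin.
- exists u; split=> //; rewrite -[X in adjoin _ _ X]mul1r; exact: mem_adjoin.
exists (colon J u :: l) => Q [[v ->] [Q1 Qprime]].
(* If the submodules of [A/J] generated by [v] and [u] share a nonzero element [s * v = t * u], then
   [J : v] and [J : u] both equal its annihilator; otherwise [J : v = (J + (u)) : v]. *)
case: (classic (exists s, adjoin J u (s * v) /\ ~ J (s * v))) => [[s [[t Ht] nJs]]|nex].
  left; have nJt : ~ colon J u t.
    by move=> Jt; apply: nJs; apply: ideal_eqmod Ht _.
  apply: pred_ext => p; split=> Hp.
    have : colon J v (p * s).
      rewrite /colon (_ : _ * _ = p * (s * v - t * u) + t * (p * u)); last by ring.
      by apply: idealD => //; apply: idealM.
    by case/Qprime.
  have : colon J u (p * t).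
    rewrite /colon (_ : _ * _ = s * (p * v) - p * (s * v - t * u)); last by ring.
    by apply: idealB => //; apply: idealM.
  by case/Pprime.
right; apply: Hl; split; last by [].
exists v; apply: pred_ext => p; split=> [Hp|Hp]; first exact: sub_adjoin.
by apply: NNPP => nJp; apply: nex; exists p.
Qed.

Lemma in_cat (T : Type) (x : T) s1 s2 : List.In x (s1 ++ s2) <-> List.In x s1 \/ List.In x s2.
Proof. exact: List.in_app_iff. Qed.

(** If [Q] contains another member of the list, that member is dropped. Otherwise an [h] avoiding
    the rest either avoids [Q] as well or is corrected by some [z] in [m] and in all the others but
    not in [Q]. *)
Lemma prime_avoidance (l : seq (A -> Prop)) :
  (forall Q, List.In Q l -> [/\ is_ideal Q, is_prime Q & exists x, m x /\ ~ Q x]) ->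
  exists h, m h /\ forall Q, List.In Q l -> ~ Q h.
Proof.
move: {2}(size l) (erefl (size l)) => n; elim: n l => [|n IH] [|Q l] //=.
  by move=> _ _; exists 0; split; [apply: ideal0|].
move=> [sl] Hl; have [IQ [Q1 Qprime] [x [mx nQx]]] := Hl Q (or_introl erefl).
case: (classic (exists Q', List.In Q' l /\ forall p, Q' p -> Q p)) => [[Q' [lQ' sQ]]|nsub].
  have [l1 [l2 El]] := List.in_split _ _ lQ'; rewrite -/(l1 ++ Q' :: l2) in El.
  have [||h [mh Hh]] := IH (Q :: l1 ++ l2).
  - by move: sl; rewrite El /= !size_cat /= addnS.
  - move=> K [<-|/in_cat HK]; apply: Hl; first by left.
    by right; rewrite El; apply/in_cat; case: HK => ?; [left|right; right].
  exists h; split=> // K [<-|]; first by apply: Hh; left.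
  rewrite El => /in_cat [Kl1|[<-|Kl2]].
  + by apply: Hh; right; apply/in_cat; left.
  + by move=> /sQ; apply: Hh; left.
  + by apply: Hh; right; apply/in_cat; right.
have [|h [mh Hh]] := IH l sl; first by move=> K HK; apply: Hl; right.
case: (classic (Q h)) => [Qh|nQh]; last by exists h; split=> // K [<-|/Hh].
have [z [mz nQz Hz]] : exists z, [/\ m z, ~ Q z & forall K, List.In K l -> K z].
  elim: l Hl nsub {sl IH Hh} => [|K l IHl] Hl nsub; first by exists x.
  have [||z [mz nQz Hz]] := IHl.
  - by move=> K' [<-|HK']; apply: Hl; [left|right; right].
  - by case=> K' [lK' sK']; apply: nsub; exists K'; split=> //; right.
  have [y [Ky nQy]] : exists y, K y /\ ~ Q y.
    apply: NNPP => ny; apply: nsub; exists K; split; first by left.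
    by move=> p Kp; apply: NNPP => nQp; apply: ny; exists p.
  have IK := Hl K (or_intror (or_introl erefl)).
  exists (y * z); split; first exact: idealM.
    by case/Qprime.
  move=> K' [<-|lK']; first by case: IK => IK _ _; apply: ideal_mulr.
  by have [IK' _ _] := Hl K' (or_intror (or_intror lK')); apply: idealM => //; apply: Hz.
exists (h + z); split; first exact: idealD.
move=> K [<-|lK] Khz.
  by apply: nQz; rewrite -(addKr h z) addrC; apply: idealB.
have [IK _ _] := Hl K (or_intror lK).
by apply: (Hh K lK); rewrite -(addrK z h); apply: idealB => //; apply: Hz.
Qed.

(** It suffices to avoid the associated primes of all [J] in the list. If such a prime [J : u]
    contained [m], then [u] would be a socle element, hence in [J], and the prime would contain
    1. *)
Lemma common_nzd (l : seq (A -> Prop)) :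
  (forall J, List.In J l -> is_ideal J /\ socle_free J) ->
  exists h, m h /\ forall J, List.In J l -> nzd J h.
Proof.
move=> Hl; pose P Q := exists J, List.In J l /\ assoc J Q.
have [Qs HQs] : exists Qs, forall Q, List.In Q Qs <-> P Q.
  have [l1 Hl1] : exists l1, forall Q, P Q -> List.In Q l1.
    rewrite /P; elim: l Hl {P} => [|J l IH] Hl; first by exists [::] => Q [J []].
    have [|l1 H1] := IH; first by move=> K HK; apply: Hl; right.
    have [l2 H2] := assoc_finite (proj1 (Hl J (or_introl erefl))).
    exists (l1 ++ l2) => Q [K [[<-|lK] HK]]; apply/in_cat; first by right; apply: H2.
    by left; apply: H1; exists K.
  (* The list is cut down to the associated primes exactly, since prime avoidance needs every member
     to be prime. *)
  have [l2 Hl2] : exists l2, forall Q, List.In Q l2 <-> List.In Q l1 /\ P Q.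
    elim: l1 {Hl1} => [|Q l1 [l2 IH]]; first by exists [::] => Q; split=> // -[].
    case: (classic (P Q)) => HQ; [exists (Q :: l2)|exists l2] => K; split=> /=.
    - by case=> [<-|/IH []]; [split=> //; left|split=> //; right].
    - by case=> [[<-|lK] PK]; [left|right; apply/IH].
    - by case/IH=> lK PK; split=> //; right.
    - by case=> [[E|lK] PK]; [rewrite E in HQ|apply/IH].
  by exists l2 => Q; rewrite Hl2; split=> [[]|PQ] //; split=> //; apply: Hl1.
have [|h [mh Hh]] := @prime_avoidance Qs.
  move=> Q /HQs [J [lJ [[u EQ] Qp]]]; have [IJ sJ] := Hl J lJ; split=> //.
    by rewrite EQ; apply: colon_ideal.
  apply: NNPP => nx; case: Qp => Q1 _; apply: Q1; rewrite EQ /colon mul1r.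
  apply: sJ => a ma; rewrite -/(colon J u a) -EQ.
  by apply: NNPP => nQa; apply: nx; exists a.
exists h; split=> // J lJ u Jhu; apply: NNPP => nJu.
have [Q [JQ Qh]] := zero_divisor_assoc (proj1 (Hl J lJ)) Jhu nJu.
by apply: (Hh Q) => //; apply/HQs; exists J.
Qed.

(** The first term [f] is exchanged for [h] through some [g] that is a nonzerodivisor modulo [J],
    [J + (f)] and [J + (h)]: the sequence starts with [f, g], then [g, f], then [g, h], then
    [h, g]. *)
Lemma depth_adjoin k J h : is_ideal J -> depth_ge k.+1 J -> m h -> nzd J h ->
  depth_ge k (adjoin J h).
Proof.
elim: k J h => [//|k IH] J h IJ [f [mf Hf Hk]] mh Hh.
have IJf := adjoin_ideal f IJ; have IJh := adjoin_ideal h IJ.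
have sJf := depth_socle_free Hk.
have sJh : socle_free (adjoin J h) by apply: socle_free_swap sJf.
have [|g [mg Hg]] := @common_nzd [:: J; adjoin J f; adjoin J h].
  move=> K [<-|[<-|[<-|[]]]]; split=> //.
  exact: nzd_socle_free Hf.
have HgJ := Hg J (or_introl erefl).
have Hgf := Hg _ (or_intror (or_introl erefl)).
have Hgh := Hg _ (or_intror (or_intror (or_introl erefl))).
have DJg : depth_ge k.+1 (adjoin J g).
  exists f; split=> //; first exact: nzd_swap Hgf.
  by rewrite adjoinC; apply: IH.
exists g; split=> //; rewrite adjoinC; apply: IH => //; first exact: adjoin_ideal.
exact: nzd_swap Hgh.
Qed.

(* The depth lemma for [0 -> A/(J : f) -> A/J -> A/(J + f) -> 0]. *)
Lemma depth_colon_adjoin k J f : is_ideal J ->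
  depth_ge k (colon J f) -> depth_ge k (adjoin J f) -> depth_ge k J.
Proof.
elim: k J => [//|k IH] J IJ Dc Da.
have IJc := colon_ideal f IJ; have IJa := adjoin_ideal f IJ.
have sc := depth_socle_free Dc; have sa := depth_socle_free Da.
have sJ : socle_free J.
  move=> u Hu; have [v Hv] : adjoin J f u by apply: sa => a /Hu; apply: sub_adjoin.
  apply: (ideal_eqmod IJ Hv); apply: sc => a ma; rewrite /colon -mulrA.
  rewrite (_ : _ * _ = a * u - a * (u - v * f)); last by ring.
  by apply: idealB; [|apply: Hu|apply: idealM].
have [|g [mg Hg]] := @common_nzd [:: J; colon J f; adjoin J f].
  by move=> K [<-|[<-|[<-|[]]]].
have HgJ := Hg J (or_introl erefl).
have Hgc := Hg _ (or_intror (or_introl erefl)).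
have Hga := Hg _ (or_intror (or_intror (or_introl erefl))).
(* By [colon_adjoin], reduction modulo [g] gives the same situation with both outer depths lowered
   by one. *)
exists g; split=> //; apply: IH; first exact: adjoin_ideal.
  by rewrite colon_adjoin //; apply: depth_adjoin.
by rewrite adjoinC; apply: depth_adjoin.
Qed.

End Depth.
End Ideals.

(** * Polynomial rings are Noetherian *)

(** The index [phi i.+1] is one where [u] is minimal among all indices beyond [phi i]; these minima
    can only grow. *)
Lemma monotone_subsequence (u : nat -> nat) :
  exists phi : nat -> nat, {homo phi : i j / (i < j)%N} /\
    forall i j, (i <= j)%N -> (u (phi i) <= u (phi j))%N.
Proof.
have Hnx n : exists k, (n <= k)%N /\ forall k', (n <= k')%N -> (u k <= u k')%N.
  have exP : exists v, exists k, (n <= k)%N /\ u k = v by exists (u n), n.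
  apply: NNPP => nex.
  have {exP} [v [k [nk uk]]] := exP.
  elim/ltn_ind: v k nk uk => v IH k nk uk; apply: nex; exists k; split=> // k' nk'.
  by rewrite leqNgt; apply/negP => lt; apply: (IH (u k') _ k' nk' erefl); rewrite -uk.
pose nx n := sval (constructive_indefinite_description _ (Hnx n)).
have nxP n : (n <= nx n)%N /\ forall k', (n <= k')%N -> (u (nx n) <= u k')%N.
  exact: svalP (constructive_indefinite_description _ (Hnx n)).
pose phi := fix phi i := if i is i'.+1 then nx (phi i').+1 else nx 0%N.
have phiS i : (phi i < phi i.+1)%N by case: (nxP (phi i).+1).
have phi_lt : {homo phi : i j / (i < j)%N} by apply: homo_ltn => //; exact: ltn_trans.
exists phi; split=> // i j; rewrite leq_eqVlt => /predU1P [-> //|/phi_lt lt].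
by case: i lt => [|i] lt /=; apply (nxP _).2 => //; apply: leq_trans (ltnW lt); case: (nxP (phi i).+1).
Qed.

(** Passing to a subsequence for one coordinate after another makes all coordinates monotone at
    once. *)
Lemma dickson n (f : nat -> 'X_{1..n}) : exists i j, (i < j)%N /\ (f i <= f j)%MM.
Proof.
suff [phi [phi_lt Hphi]] : exists phi : nat -> nat, {homo phi : i j / (i < j)%N} /\
    forall x, x \in enum 'I_n -> forall i j, (i <= j)%N -> (f (phi i) x <= f (phi j) x)%N.
  exists (phi 0%N), (phi 1%N); split; first exact: phi_lt.
  by apply/mnm_lepP => x; apply: Hphi => //; rewrite mem_enum.
elim: (enum _) => [|y s [phi [phi_lt Hphi]]]; first by exists id; split.
have [psi [psi_lt Hpsi]] := monotone_subsequence (fun i => f (phi i) y).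
exists (phi \o psi); split; first by move=> i j /psi_lt /phi_lt.
move=> x; rewrite inE => /predU1P [->|xs] i j ij; first exact: Hpsi.
apply: Hphi => //; move: ij; rewrite leq_eqVlt => /predU1P [-> //|lt].
exact/ltnW/psi_lt.
Qed.

Section MPolyNoetherian.
Variables (R : fieldType) (n : nat).
Local Notation P := {mpoly R[n]}.

Lemma mlead_reduce (p q : P) : p != 0 -> q != 0 -> (mlead p <= mlead q)%MM ->
  exists c : P, q - c * p = 0 \/ (mlead (q - c * p) < mlead q)%O.
Proof.
move=> p0 q0 pq; pose c : P := (mleadc q / mleadc p) *: 'X_[mlead q - mlead p].
have cp0 : mleadc p != 0 by rewrite mleadc_eq0.
have cq0 : mleadc q != 0 by rewrite mleadc_eq0.
have a0 : mleadc q / mleadc p != 0 by rewrite mulf_neq0 ?invr_eq0.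
have X0 : 'X_[R, mlead q - mlead p] != 0.
  by rewrite -mleadc_eq0 mleadXm mcoeffX eqxx oner_neq0.
have c0 : c != 0 by rewrite mscalerI negb_or a0.
have lc : mlead c = (mlead q - mlead p)%MM by rewrite mleadZ // mleadXm.
have lcp : mlead (c * p) = mlead q by rewrite mleadM // lc submK.
exists c; have [->|d0] := eqVneq (q - c * p) 0; [by left|right].
rewrite lt_neqAle; apply/andP; split.
  apply: contraNneq d0 => E; rewrite -mleadc_eq0 E mcoeffB -{2}lcp.
  rewrite mleadM // mleadcM lc mcoeffZ mcoeffX eqxx mulr1 divfK //.
  by rewrite subrr.
by apply: le_trans (mleadB_le _ _) _; rewrite lcp joinxx.
Qed.

(** In a strictly increasing chain, let [p i] have the least leading monomial among the elements new
    at step [i]. By Dickson's lemma some earlier [p i] has a leading monomial dividing that of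
    [p j], and one division step yields a smaller new element. *)
Lemma mpoly_noetherian : @noetherian P.
Proof.
move=> F [J0 FJ0]; apply: NNPP => nmax.
pose T := {J : P -> Prop | is_ideal J /\ F J}.
have Hnx (J : T) : exists K : T,
    (forall p, sval J p -> sval K p) /\ exists p, sval K p /\ ~ sval J p.
  apply: NNPP => nK; apply: nmax; case: J nK => J [IJ FJ] nK; exists J; split=> //.
  move=> J' IJ' FJ' JJ' p J'p; apply: NNPP => nJp; apply: nK.
  by exists (exist _ J' (conj IJ' FJ')); split=> //; exists p.
pose nx J := sval (constructive_indefinite_description _ (Hnx J)).
have nxP J := svalP (constructive_indefinite_description _ (Hnx J)).
pose ch := fix ch i : T := if i is i'.+1 then nx (ch i') else exist _ J0 FJ0.
have chI i : is_ideal (sval (ch i)) by case: (svalP (ch i)).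
have ch_mono i j : (i <= j)%N -> forall p, sval (ch i) p -> sval (ch j) p.
  elim: j => [|j IH]; first by rewrite leqn0 => /eqP->.
  rewrite leq_eqVlt => /predU1P [-> //|ij] p Hp; apply: (nxP (ch j)).1.
  exact: IH.
pose D i p := sval (ch i.+1) p /\ ~ sval (ch i) p.
have Hp i : exists p, D i p /\ forall q, D i q -> ~~ (mlead q < mlead p)%O.
  have [p Dp] : exists p, D i p by exact: (nxP (ch i)).2.
  apply: NNPP => nex; move: {2}(mlead p) (erefl (mlead p)) => l.
  elim/(well_founded_ind (@ltom_wf n)): l p Dp => l IH p Dp El; apply: nex; exists p; split=> // q Dq.
  by apply/negP => lt; apply: (IH (mlead q) _ q Dq erefl); rewrite -El.
pose p i := sval (constructive_indefinite_description _ (Hp i)).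
have pP i : D i (p i) /\ forall q, D i q -> ~~ (mlead q < mlead (p i))%O.
  exact: svalP (constructive_indefinite_description _ (Hp i)).
have [i [j [ij lij]]] := dickson (fun i => mlead (p i)).
have p0 k : p k != 0.
  by apply/eqP => E; case: (pP k) => -[_ []]; rewrite E; apply: ideal0.
have [c Hc] := mlead_reduce (p0 i) (p0 j) lij.
have [[pj npj] minj] := pP j; have [[pi _] _] := pP i.
have cpi : sval (ch j) (c * p i) by apply: idealM => //; apply: ch_mono pi.
have nq : ~ sval (ch j) (p j - c * p i) by move=> H; apply: npj; apply: ideal_eqmod H _.
case: Hc => [E|lt]; first by apply: nq; rewrite E; apply: ideal0.
suff /minj /negP : D j (p j - c * p i) by apply.
by split=> //; apply: idealB => //; apply: ch_mono cpi.
Qed.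

End MPolyNoetherian.

(** * Ideals graded in one variable *)

(** As a measure, the degree in [x] alone gives access to homogeneous elements and components for
    the grading by powers of [x]. *)
Definition expo n (x : 'I_n) (m : 'X_{1..n}) : nat := m x.

HB.instance Definition _ n (x : 'I_n) :=
  isMeasure.Build n (expo x) (mnm0E x) (fun m1 m2 => mnmDE x m1 m2).

Lemma in_map_iota (T : Type) (F : nat -> T) J k :
  List.In J [seq F i | i <- iota 0 k] <-> exists2 i, (i < k)%N & J = F i.
Proof.
elim: k => [|k IH]; first by split=> // -[].
rewrite -addn1 iotaD map_cat; split.
  case/in_cat => [/IH [i ik ->]|[<-|[]]]; first by exists i => //; rewrite addn1 ltnS ltnW.
  by exists k; rewrite // addn1.
case=> i; rewrite addn1 ltnS leq_eqVlt => /predU1P [-> ->|ik E]; apply/in_cat.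
  by right; left.
by left; apply/IH; exists i.
Qed.

Section Graded.
Variables (R : fieldType) (n : nat).
Local Notation P := {mpoly R[n]}.
Local Notation mx := (@in_max_ideal R n).
Local Notation D := (depth_ge mx).

Lemma max_ideal : is_ideal mx.
Proof.
split; rewrite /in_max_ideal; first by rewrite mcoeff0.
  by move=> p q Hp Hq; rewrite mcoeffD Hp Hq addr0.
by move=> c p Hp; rewrite rmorphM /= Hp mulr0.
Qed.

Lemma max_idealX (x : 'I_n) : mx 'X_x.
Proof. by rewrite /in_max_ideal mcoeffX mnm1_eq0. Qed.

Lemma mpoly_ideal_ind (J : P -> Prop) (p : P) : is_ideal J ->
  (forall w, p@_w != 0 -> J 'X_[w]) -> J p.
Proof.
move=> IJ Hw; rewrite [p]mpolyE big_seq; apply: ideal_sum => // w.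
by rewrite mcoeff_msupp => /Hw Jw; rewrite -mul_mpolyC; apply: idealM.
Qed.

Lemma mpolyX_dvd (u : 'X_{1..n}) (p : P) : (forall w, p@_w != 0 -> (u <= w)%MM) ->
  exists q : P, p = q * 'X_[u] /\ forall w, q@_w = p@_(w + u).
Proof.
move=> Hp; pose q : P := \sum_(w <- msupp p) p@_w *: 'X_[w - u].
suff E : p = q * 'X_[u] by exists q; split=> // w; rewrite [in RHS]E addmC mcoeffMX.
rewrite {1}[p]mpolyE mulr_suml big_seq [RHS]big_seq; apply: eq_bigr => w.
by rewrite mcoeff_msupp => /Hp uw; rewrite -scalerAl -mpolyXD submK.
Qed.

Definition mfilter (pr : pred 'X_{1..n}) (p : P) : P :=
  \sum_(w <- msupp p | pr w) p@_w *: 'X_[w].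

Lemma mcoeff_mfilter pr p w : (mfilter pr p)@_w = if pr w then p@_w else 0.
Proof.
rewrite /mfilter raddf_sum /=.
under eq_bigr do rewrite mcoeffZ mcoeffX.
case: (boolP (w \in msupp p)) => [wp|wp].
  rewrite big_mkcond /= (bigD1_seq w) ?msupp_uniq //= eqxx mulr1 big1 ?addr0 // => w' w'w.
  by rewrite (negbTE w'w) mulr0 if_same.
rewrite (memN_msupp_eq0 wp) if_same big_seq_cond big1 // => w' /andP [w'p _].
by rewrite [_ == _](_ : _ = false) ?mulr0 //; apply: contraNF wp => /eqP <-.
Qed.

Variable x : 'I_n.
Implicit Types (p q h s u : P) (I : P -> Prop).
Local Notation X := ('X_x : P).
Local Notation comp := (pihomog (expo x)).
Local Notation hom i p := (p \is i.-homog for (expo x)).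

Lemma homX i : hom i (X ^+ i).
Proof. by rewrite mpolyXn dhomogX /= /expo mulmnE mnm1E eqxx mul1n. Qed.

Lemma compM i e p q : hom e q -> comp (i + e) (p * q) = comp i p * q.
Proof.
move=> Hq; rewrite {1}[p](pihomog_partitionE (k := (mmeasure (expo x) p + i).+1) (mf := expo x)).
  rewrite mulr_suml raddf_sum /= (bigD1 (inord i)) //= inordK; last by lia.
  rewrite pihomog_dE; last by apply: dhomogM => //; exact: pihomogP.
  rewrite big1 ?addr0 // => d; rewrite -val_eqE /= inordK; last by lia.
  move=> di; apply: pihomog_ne0 (dhomogM (pihomogP _ _ _) Hq).
  by rewrite eqn_add2r.
by lia.
Qed.

Lemma compM0 i e p q : hom e q -> (i < e)%N -> comp i (p * q) = 0.
Proof.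
move=> Hq ie; rewrite {1}[p](pihomog_partitionE (leqnn (mmeasure (expo x) p))).
rewrite mulr_suml raddf_sum /= big1 // => d _.
apply: pihomog_ne0 (dhomogM (pihomogP _ _ _) Hq).
by rewrite neq_ltn ltn_addl ?orbT.
Qed.

Lemma compMl i h p : hom 0 h -> comp i (h * p) = h * comp i p.
Proof. by move=> Hh; rewrite mulrC -{1}[i]addn0 (compM _ _ Hh) mulrC. Qed.

Lemma hom_dvd i p : hom i p -> exists2 q, hom 0 q & p = q * X ^+ i.
Proof.
move/dhomogP=> Hp; have [|q [E Hq]] := @mpolyX_dvd (U_(x) *+ i)%MM p.
  move=> w; rewrite -mcoeff_msupp => /Hp <-; apply/mnm_lepP => y.
  by rewrite mulmnE mnm1E; case: eqP => [->|_]; rewrite ?mul1n.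
exists q; last by rewrite mpolyXn.
apply/dhomogP => w; rewrite mcoeff_msupp Hq -mcoeff_msupp => /Hp.
by rewrite /= /expo mnmDE mulmnE mnm1E eqxx mul1n; lia.
Qed.

Lemma mcoeff_comp i p w : (comp i p)@_w = if w x == i then p@_w else 0.
Proof. by rewrite -(mcoeff_mfilter (fun w => w x == i)). Qed.

Lemma sub_comp0 p : exists q, p - comp 0 p = q * X.
Proof.
have [|q [E _]] := @mpolyX_dvd U_(x)%MM (p - comp 0 p); last by exists q.
move=> w; rewrite mcoeffB mcoeff_comp lep1mP; case: (w x == 0%N) => //.
by rewrite subrr eqxx.
Qed.

Lemma max_comp0 p : mx p -> mx (comp 0 p).
Proof. by rewrite /in_max_ideal mcoeff_comp mnm0E eqxx. Qed.

Definition xgraded (I : P -> Prop) := forall p i, I p -> I (comp i p).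

Lemma nzd_comp0 L h : is_ideal L -> L X -> nzd L h -> nzd L (comp 0 h).
Proof.
move=> IL LX Hh u Hu; apply: Hh; have [q E] := sub_comp0 h.
rewrite -(subrK (comp 0 h) h) E mulrDl; apply: idealD => //.
by rewrite mulrAC; apply: idealM.
Qed.

(* [I] being graded in [x], [slice I i] is [I_i + (x)], where [I_i] is the coefficient ideal
   of [x ^ i]. *)
Definition slice I i := adjoin (colon I (X ^+ i)) X.

Lemma slice_ideal I i : is_ideal I -> is_ideal (slice I i).
Proof. by move=> II; apply/adjoin_ideal/colon_ideal. Qed.

Lemma sliceX I i : is_ideal I -> slice I i X.
Proof. by move=> II; rewrite -[X]mul1r; apply/mem_adjoin/colon_ideal. Qed.

(** Membership in the slice puts some [(s - c * x) * x ^ i] into [I]; its component of degree [i] is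
    [s * x ^ i]. *)
Lemma slice_free I i s : xgraded I -> hom 0 s -> slice I i s -> I (s * X ^+ i).
Proof.
move=> gI Hs [c /gI -/(_ i)]; rewrite mulrBl raddfB /= -mulrA -exprS.
rewrite (compM0 _ (homX i.+1)) // subr0 -{1}[i]add0n (compM _ _ (homX i)).
by rewrite pihomog_dE.
Qed.

(** Multiplication by [h] preserves the degree in [x], so it can be tested on each component
    [si * x ^ i], that is, on the coefficient ideals. *)
Lemma nzd_slices I h : is_ideal I -> xgraded I -> hom 0 h ->
  (forall i, nzd (slice I i) h) -> nzd I h.
Proof.
move=> II gI Hh Hn s Hs.
rewrite [s](pihomog_partitionE (leqnn (mmeasure (expo x) s))); apply: ideal_sum => // i _.
have [si Hsi E] := hom_dvd (pihomogP (expo x) i s); rewrite E.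
apply: slice_free => //; apply: Hn; apply: sub_adjoin.
by rewrite /colon -mulrA -E -compMl //; apply: gI.
Qed.

Lemma slice_mono I i j : is_ideal I -> (i <= j)%N -> forall p, slice I i p -> slice I j p.
Proof.
move=> II ij p [c Hc]; exists c; rewrite /colon -(subnKC ij) exprD mulrA.
exact: ideal_mulr.
Qed.

(** The slices increase with [i] and become constant, so only finitely many have to be served. *)
Lemma common_nzd_slices I : is_ideal I -> (forall i, socle_free mx (slice I i)) ->
  exists h, mx h /\ forall i, nzd (slice I i) h.
Proof.
move=> II Hs.
have [|J [_ [K ->] maxK]] := @mpoly_noetherian R n (fun J => exists i, J = slice I i).
  by exists (slice I 0); split; [exact: slice_ideal|exists 0%N].
have [|h [mh Hh]] := @common_nzd _ mx max_ideal (@mpoly_noetherian R n) [seq slice I i | i <- iota 0 K.+1].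
  by move=> L /in_map_iota [i _ ->]; split; [exact: slice_ideal|exact: Hs].
exists h; split=> // i; apply: Hh; apply/in_map_iota.
case: (leqP i K) => [iK|/ltnW iK]; first by exists i.
exists K => //; apply: pred_ext => p; split; last exact: slice_mono.
apply: maxK; [exact: slice_ideal|by exists i|exact: slice_mono].
Qed.

(* A socle element of a slice forces depth at most one: it spans a copy of [R[x]] in the quotient
   by [I], on which [f] acts as [q x ^ l] with [q 0 != 0]. *)
Lemma slice_socle_free I : is_ideal I -> xgraded I -> D 2 I ->
  forall i, socle_free mx (slice I i).
Proof.
move=> II gI D2 i u Hu; apply: NNPP => nu; have noeth := @mpoly_noetherian R n.
have Iu := slice_ideal i II.
have [qu Eu] := sub_comp0 u; pose u0 := comp 0 u; pose v := u0 * X ^+ i.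
have nLu0 : ~ slice I i u0.
  move=> Lu0; apply: nu; rewrite -(subrK u0 u); apply: idealD => //.
  by rewrite Eu; apply: idealM => //; apply: sliceX.
have nv : ~ I v by move=> Iv; apply: nLu0; apply: sub_adjoin.
(* By the socle property of [u], a multiple of [v] depends modulo [I] only on the pure powers of [x]
   in the multiplier. *)
have Hfree h : hom 0 h -> mx h -> I (h * v).
  move=> Hh mh; rewrite mulrA; apply: slice_free => //.
    by apply: (dhomogM (d := 0) (e := 0)) => //; exact: pihomogP.
  rewrite (_ : _ * _ = h * u - h * (u - u0)); last by ring.
  by apply: idealB; rewrite // ?Eu; [apply: Hu|do !apply: idealM => //; apply: sliceX].
have Hmono (w : 'X_{1..n}) y : y != x -> w y != 0%N -> I ('X_[w] * v).
  move=> yx wy; rewrite -(submK (m := U_(y)%MM) (m' := w)); last by rewrite lep1mP.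
  rewrite mpolyXD -mulrA; apply: idealM => //; apply: Hfree; last exact: max_idealX.
  by rewrite dhomogX /= /expo mnm1E (negbTE yx).
have [f [mf Hf D1f]] := D2.
(* The exponent [i.+1] ensures [t > i] for the power [x ^ t] below. *)
have DF : D 1 (adjoin I (f ^+ i.+1)).
  apply: depth_adjoin => //; [exact: max_ideal| |exact: nzdX].
  by rewrite exprS; apply: ideal_mulr => //; exact: max_ideal.
have {D1f} sF := depth_socle_free DF.
pose pure (w : 'X_{1..n}) := w == (U_(x) *+ w x)%MM :> 'X_{1..n}; pose p := mfilter pure f.
have Hfp : I ((f - p) * v).
  apply: (@mpoly_ideal_ind (colon I v)); first exact: colon_ideal.
  move=> w; rewrite mcoeffB mcoeff_mfilter; case: ifPn; first by rewrite subrr eqxx.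
  move=> Hw _; have [y] : exists y, w y != (U_(x) *+ w x)%MM y.
    apply/existsP; apply: contraR Hw => /existsPn E; apply/eqP/mnmP => y.
    by apply/eqP; rewrite -[_ == _]negbK.
  rewrite mulmnE mnm1E; have [<-|xy] := eqVneq x y; first by rewrite mul1n eqxx.
  by rewrite mul0n; apply: Hmono; rewrite eq_sym.
have [l [q [l0 Ep q0]]] : exists l q, [/\ (0 < l)%N, p = q * X ^+ l & q@_0%MM != 0].
  have [w pw minw] : exists2 w, p@_w != 0 & forall w', p@_w' != 0 -> (w x <= w' x)%N.
    have [w pw] : exists w, p@_w != 0.
      apply: NNPP => nex; have p0 : p = 0.
        by apply/mpolyP => w; rewrite mcoeff0; apply/eqP/negPn/negP => pw; apply: nex; exists w.
      by apply: nv; apply: Hf; move: Hfp; rewrite p0 subr0.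
    apply: NNPP => nex; move: {2}(w x) (erefl (w x)) => k.
    elim/ltn_ind: k w pw => k IH w pw wk; apply: nex; exists w => // w' pw'.
    by rewrite leqNgt; apply/negP => lt; apply: (IH (w' x) _ w' pw' erefl); rewrite -wk.
  have pureP w' : p@_w' != 0 -> w' = (U_(x) *+ w' x)%MM.
    by rewrite mcoeff_mfilter; case: ifP => [/eqP|]; rewrite ?eqxx.
  have [|q [E Hq]] := @mpolyX_dvd (U_(x) *+ w x)%MM p.
    move=> w' pw'; apply/mnm_lepP => y; rewrite [leqRHS](_ : _ = (U_(x) *+ w' x)%MM y); last by rewrite -pureP.
    by rewrite !mulmnE leq_mul2l minw ?orbT.
  exists (w x), q; rewrite mpolyXn; split=> //; last by rewrite Hq add0m -pureP.
  rewrite lt0n; apply/eqP => wx; have := pw.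
  by rewrite (pureP w pw) wx mulm0n mcoeff_mfilter mf if_same eqxx.
pose e1 := q ^+ i.+1; pose t := (l * i.+1)%N; pose F := f ^+ i.+1.
have it : (i < t)%N by rewrite /t; nia.
have e10 : e1@_0%MM != 0 by rewrite rmorphXn expf_neq0.
have HFv : I (F * v - e1 * X ^+ t * v).
  rewrite /F /e1 /t exprM -exprMn -Ep; elim: i.+1 => [|k IH].
    by rewrite !expr0 subrr; apply: ideal0.
  rewrite !exprS (_ : _ - _ = f * (f ^+ k * v - p ^+ k * v) + p ^+ k * ((f - p) * v)); last by ring.
  by apply: idealD => //; apply: idealM.
(* Modulo [I + (F)], [a] is nonzero but killed by [x ^ t] and by all elements of the maximal ideal
   free of [x]; the last nonzero [x ^ k * a] is a socle element, against [sF]. *)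
pose a := e1 * v; have nQa : ~ adjoin I F a.
  case=> c Hc; have : I (a - e1 * X ^+ t * c).
    apply: (nzdX (k := i.+1) Hf).
    rewrite -/F (_ : F * (a - e1 * X ^+ t * c) = e1 * (F * v - e1 * X ^+ t * v) + e1 * X ^+ t * (a - c * F)).
      by apply: idealD => //; apply: idealM.
    by rewrite /a; ring.
  (* As [t > i], the multiple of [x ^ t] has no component of degree [i]; the nonzero constant term
     of [e1] then puts [v] into [I]. *)
  move/gI => /(_ i); rewrite raddfB /= mulrAC (compM0 _ (homX t)) // subr0 /a /v mulrA.
  rewrite -{1}[i]add0n (compM _ _ (homX i)) [e1 * u0]mulrC compMl; last exact: pihomogP.
  rewrite mulrAC -/v => Iv; apply: nv.
  have Ih : I ((comp 0 e1 - (e1@_0%MM)%:MP) * v).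
    apply: Hfree; last by rewrite /in_max_ideal mcoeffB mcoeff_comp mnm0E eqxx mcoeffC eqxx mulr1 subrr.
    apply: rpredB; first exact: pihomogP.
    by rewrite -[_%:MP]mulr1 mul_mpolyC; apply/rpredZ/dhomog1.
  rewrite -[v]mul1r -mpolyC1 -(mulVf e10) mpolyCM -mulrA; apply: idealM => //.
  rewrite (_ : _ * v = v * comp 0 e1 - (comp 0 e1 - (e1@_0%MM)%:MP) * v); last by ring.
  exact: idealB.
apply: nQa; have IQ : is_ideal (adjoin I F) by apply: adjoin_ideal.
have Qt : adjoin I F (X ^+ t * a).
  exists v; rewrite (_ : _ - _ = - (F * v - e1 * X ^+ t * v)); last by rewrite /a; ring.
  exact: idealN.
elim: t {it HFv} Qt => [|k IH]; first by rewrite expr0 mul1r.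
move=> Hk; apply: IH; apply: sF => h mh; have [q' E] := sub_comp0 h.
rewrite -(subrK (comp 0 h) h) E mulrDl; apply: idealD => //.
  by rewrite (_ : q' * X * (X ^+ k * a) = q' * (X ^+ k.+1 * a)); [apply: idealM|rewrite exprS; ring].
rewrite (_ : comp 0 h * (X ^+ k * a) = (X ^+ k * e1) * (comp 0 h * v)); last by rewrite /a; ring.
by apply: idealM => //; apply: sub_adjoin; apply: Hfree; [exact: pihomogP|exact: max_comp0].
Qed.

Lemma adjoin_xgraded I h : is_ideal I -> xgraded I -> hom 0 h -> xgraded (adjoin I h).
Proof.
move=> II gI Hh p i [c Hc]; exists (comp i c).
by rewrite mulrC -compMl // -raddfB mulrC; apply: gI.
Qed.

(** In [p * x = c * h] modulo [I], the component of degree 0 puts [comp 0 c * h], hence [comp 0 c],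
    into [I]. So [c] may be replaced by a multiple [q * x], and [p - q * h] lies in [I : x]. *)
Lemma xgraded_colon_adjoin I h : is_ideal I -> xgraded I -> hom 0 h -> nzd I h ->
  colon (adjoin I h) X = adjoin (colon I X) h.
Proof.
move=> II gI Hh nh; apply: pred_ext => p; split=> [[c Hc]|[c Hc]]; last first.
  by exists (c * X); rewrite mulrAC -mulrBl.
have [q E] := sub_comp0 c; exists q; rewrite /colon.
rewrite (_ : _ * _ = p * X - c * h + h * comp 0 c); last first.
  by rewrite -{1}(subrK (comp 0 c) c) E; ring.
apply: idealD => //; apply: idealM => //; apply: nh; rewrite -compMl //.
have := gI _ 0%N Hc; rewrite raddfB /= (compM0 _ (homX 1)) // sub0r => /(idealN II).
by rewrite opprK mulrC.
Qed.

(** An element free of [x] that is a nonzerodivisor on every slice is one modulo [I], [I : x] and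
    [I + (x)], the last being slice 0, and adjoining it commutes with both operations. It exists for
    depth at least 2, by [slice_socle_free]. *)
Lemma depth_colon_adjoin_var k I : is_ideal I -> xgraded I -> D k I ->
  D k (colon I X) /\ D k.-1 (adjoin I X).
Proof.
have noeth := @mpoly_noetherian R n; have mI := max_ideal.
elim: k I => [//|[|k] IH] I II gI Dk.
  by case: Dk => f [mf Hf _]; split=> //; exists f; split=> //; apply: nzd_colon.
have [h [mh Hh]] : exists h, mx h /\ forall i, nzd (slice I i) h.
  by apply: common_nzd_slices => //; apply: slice_socle_free (depth_geW _ Dk).
pose h0 := comp 0 h; have hom0 : hom 0 h0 by exact: pihomogP.
have mh0 : mx h0 by exact: max_comp0.
have Hh0 i : nzd (slice I i) h0 by apply: nzd_comp0; [exact: slice_ideal|exact: sliceX|].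
have nh0 : nzd I h0 by apply: nzd_slices.
have Ih0 := adjoin_ideal h0 II.
have [] := IH (adjoin I h0) Ih0 (adjoin_xgraded II gI hom0) (depth_adjoin mI noeth II Dk mh0 nh0).
rewrite xgraded_colon_adjoin //= adjoinC => Dc Da.
split; first by exists h0; split=> //; apply: nzd_colon.
exists h0; split=> //; move: (Hh0 0%N); rewrite /slice expr0.
by rewrite (_ : colon I 1 = I) //; apply: pred_ext => p; rewrite /colon mulr1.
Qed.

End Graded.

(** * Monomial ideals *)

Section Monomial.
Variables (R : fieldType) (n : nat).
Local Notation P := {mpoly R[n]}.
Local Notation mx := (@in_max_ideal R n).
Local Notation M := 'X_{1..n}.
Implicit Types (T : M -> Prop) (p q : P) (u w : M).

Definition upset T := forall u w, (u <= w)%MM -> T u -> T w.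
(** Given by its set of exponents, a monomial ideal has colons and sums by monomials that are
    operations on the upset [T]. *)
Definition mono_ideal T : P -> Prop := fun p => forall w, p@_w != 0 -> T w.
Local Notation DT k T := (depth_ge mx k (mono_ideal T)).

Lemma mono_ideal_ext T T' : (forall w, T w <-> T' w) -> mono_ideal T = mono_ideal T'.
Proof. by move=> /pred_ext ->. Qed.

Lemma mem_monoX T u : T u -> mono_ideal T 'X_[u].
Proof. by move=> Tu w; rewrite mcoeffX; have [<-|_] := eqVneq u w; rewrite ?eqxx. Qed.

Lemma mcoeffM_supp p q w : (p * q)@_w != 0 ->
  exists u v, [/\ p@_u != 0, q@_v != 0 & w = (u + v)%MM].
Proof.
rewrite -mcoeff_msupp => /msuppM_le /allpairsP [[u v] [/= up vq ->]].
by exists u, v; rewrite -!mcoeff_msupp.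
Qed.

Lemma mcoeffMX_supp p u w : (p * 'X_[u])@_w != 0 ->
  exists2 v, p@_v != 0 & w = (v + u)%MM.
Proof.
case/mcoeffM_supp => v [u' [pv]]; rewrite mcoeffX; have [<- _ ->|_] := eqVneq u u'; last by rewrite eqxx.
by exists v.
Qed.

Lemma mono_is_ideal T : upset T -> is_ideal (mono_ideal T).
Proof.
move=> uT; split.
- by move=> w; rewrite mcoeff0 eqxx.
- move=> p q Hp Hq w; rewrite mcoeffD; have [->|pw _] := eqVneq p@_w 0; last exact: Hp.
  by rewrite add0r => /Hq.
- move=> c p Hp w /mcoeffM_supp [u [v [_ pv ->]]].
  by apply: uT (Hp v pv); apply: lem_addl.
Qed.

Lemma mono_xgraded T x : xgraded x (mono_ideal T).
Proof.
by move=> p i Hp w; rewrite mcoeff_comp; case: ifP => _; [apply: Hp|rewrite eqxx].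
Qed.

Lemma colon_mono T u : colon (mono_ideal T) 'X_[u] = mono_ideal (fun w => T (w + u)%MM).
Proof.
apply: pred_ext => p; split=> Hp w pw.
  by apply: Hp; rewrite addmC mcoeffMX.
by have [v pv ->] := mcoeffMX_supp pw; apply: Hp.
Qed.

Lemma adjoin_mono T u : upset T ->
  adjoin (mono_ideal T) 'X_[u] = mono_ideal (fun w => T w \/ (u <= w)%MM).
Proof.
move=> uT; apply: pred_ext => p; split=> [[c Hc] w pw|Hp].
  have [E|cw] := eqVneq ((c * 'X_[u])@_w) 0.
    by left; apply: Hc; rewrite mcoeffB E subr0.
  by have [v _ ->] := mcoeffMX_supp cw; right; apply: lem_addl.
have [|q [E _]] := @mpolyX_dvd _ _ u (mfilter (fun w => (u <= w)%MM) p).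
  by move=> w; rewrite mcoeff_mfilter; case: ifP => //; rewrite eqxx.
exists q; rewrite -E => w; rewrite mcoeffB mcoeff_mfilter; case: ifP => uw.
  by rewrite subrr eqxx.
by rewrite subr0 => /Hp []; rewrite ?uw.
Qed.

Lemma nzd_mono T u : (forall w, T (w + u)%MM -> T w) -> nzd (mono_ideal T) 'X_[u].
Proof. by move=> Hu p Hp w pw; apply: Hu; apply: Hp; rewrite mulrC addmC mcoeffMX. Qed.

Lemma upset_shift T u : upset T -> upset (fun w => T (w + u)%MM).
Proof.
move=> uT v w /mnm_lepP vw; apply: uT; apply/mnm_lepP => i.
by rewrite !mnmDE leq_add2r.
Qed.

Lemma upset_or T T' : upset T -> upset T' -> upset (fun w => T w \/ T' w).
Proof. by move=> uT uT' v w vw [/(uT _ _ vw)|/(uT' _ _ vw)]; [left|right]. Qed.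

Lemma upset_ge x j : upset (fun w => (j <= w x)%N).
Proof. by move=> v w /mnm_lepP /(_ x) vw jv; apply: leq_trans vw. Qed.

Lemma lemX x j w : ((U_(x) *+ j)%MM <= w)%MM = (j <= w x)%N.
Proof.
apply/mnm_lepP/idP => [/(_ x)|jw i]; rewrite mulmnE mnm1E ?eqxx ?mul1n //.
by case: eqP => [<-|_]; rewrite ?mul1n ?mul0n.
Qed.

(** One variable at a time, as a monomial ideal is graded in each variable. *)
Lemma depth_mono_colon k T u : upset T -> DT k T -> DT k (fun w => T (w + u)%MM).
Proof.
move: {2}(mdeg u) (erefl (mdeg u)) => d; elim: d u T => [|d IH] u T.
  move/eqP; rewrite mdeg_eq0 => /eqP -> uT.
  by rewrite (mono_ideal_ext (T' := T)) // => w; rewrite addm0.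
move=> du uT DT; have [x ux] : exists x, u x != 0%N.
  apply/existsP; apply: contraPT du => /existsPn E.
  suff -> : u = 0%MM by rewrite mdeg0.
  by apply/mnmP => i; rewrite mnm0E; apply/eqP; rewrite -[_ == _]negbK.
have Eu := submK (m := U_(x)%MM) (m' := u); rewrite lep1mP in Eu.
have [Dc _] := depth_colon_adjoin_var (mono_is_ideal uT) (mono_xgraded (x := x)) DT.
rewrite colon_mono in Dc; have := IH (u - U_(x))%MM _ _ (upset_shift uT) Dc.
rewrite (mono_ideal_ext (T' := fun w => T (w + u)%MM)) => [|w]; last by rewrite -addmA Eu.
by apply; move: du; rewrite -{1}(Eu ux) mdegD mdeg1 addn1 => -[].
Qed.

Lemma depth_mono_adjoin k T (s : seq 'I_n) : upset T -> DT k T ->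
  DT (k - size s) (fun w => T w \/ has (fun v => 0 < w v)%N s).
Proof.
elim: s k T => [|x s IH] k T uT DT /=.
  by rewrite subn0 (mono_ideal_ext (T' := T)) // => w; split=> [[]|] //; left.
have [_] := depth_colon_adjoin_var (mono_is_ideal uT) (mono_xgraded (x := x)) DT.
rewrite adjoin_mono // -subn1 => H.
have {}H := IH _ _ (upset_or uT (fun u w uw xu => lepm_trans xu uw)) H.
rewrite (mono_ideal_ext (T' := fun w => (T w \/ (U_(x) <= w)%MM) \/ has (fun v => 0 < w v)%N s)).
  by rewrite -add1n subnDA.
by move=> w; rewrite lep1mP -lt0n; split=> [[?|/orP []]|[[?|->]|->]]; rewrite ?orbT; auto.
Qed.

Definition zero_out x w : M := [multinom if i == x then 0%N else w i | i < n].

Lemma zero_out_le x w : (zero_out x w <= w)%MM.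
Proof. by apply/mnm_lepP => i; rewrite mnmE; case: ifP. Qed.

Lemma zero_out_id x w : w x = 0%N -> zero_out x w = w.
Proof. by move=> wx; apply/mnmP => i; rewrite mnmE; case: eqP => // ->. Qed.

(** Below exponent [j], membership in [T] does not depend on the exponent of [x]. With [T'] the
    monomials whose part free of [x] lies in [T], [T + (x ^ j) = T' + (x ^ j)], and [x ^ j] is a
    nonzerodivisor modulo [T']. *)
Lemma depth_adjoin_power k T x j : upset T -> (0 < j)%N ->
  (forall w, T w -> (w x < j)%N -> T (zero_out x w)) ->
  DT k (fun w => T w \/ (j <= w x)%N) <-> DT k.+1 (fun w => T (zero_out x w)).
Proof.
move=> uT j0 HT; set T' := fun w => T (zero_out x w).
have uT' : upset T'.
  move=> u w /mnm_lepP uw; apply: uT; apply/mnm_lepP => i; rewrite !mnmE.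
  by case: ifP.
rewrite (mono_ideal_ext (T' := fun w => T' w \/ ((U_(x) *+ j)%MM <= w)%MM)); last first.
  move=> w; rewrite lemX; split=> [[Tw|]|[T'w|]]; try by right.
    by case: (leqP j (w x)) => [jw|wj]; [right|left; apply: HT].
  by left; apply: uT T'w; apply: zero_out_le.
rewrite -adjoin_mono //.
have nX : nzd (mono_ideal T') 'X_[U_(x) *+ j].
  apply: nzd_mono => w; rewrite /T'; congr T; apply/mnmP => i; rewrite !mnmE mulmnE mnm1E.
  by rewrite eq_sym; case: eqP => //; rewrite addn0.
have mX : mx 'X_[U_(x) *+ j].
  by rewrite -mpolyXn -(prednK j0) exprS; apply: ideal_mulr; [exact: max_ideal|exact: max_idealX].
split=> [H|H]; first by exists 'X_[U_(x) *+ j].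
by apply: depth_adjoin; [exact: max_ideal|exact: mpoly_noetherian|exact: mono_is_ideal| |..].
Qed.

(** By [depth_adjoin_power] with exponents 1 and [j], both sides say that the same ideal [T'] has
    depth at least [k.+1]. *)
Lemma depth_power_var k T x j : upset T -> (0 < j)%N ->
  (forall w, T w -> (w x < j)%N -> T (zero_out x w)) ->
  DT k (fun w => T w \/ (0 < w x)%N) <-> DT k (fun w => T w \/ (j <= w x)%N).
Proof.
move=> uT j0 HT; apply: iff_trans (iff_sym (depth_adjoin_power k uT j0 HT)).
apply: depth_adjoin_power => // w Tw.
by rewrite ltnS leqn0 => /eqP /zero_out_id ->.
Qed.

(* [(T + y ^ j) : x ^ j = T : x ^ j], so the depth lemma for [x ^ j] compares [T] with
   [T + x ^ j] and [(T + y ^ j) : x ^ j]. *)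
Lemma depth_ge_of_adjoin_vars k T x y j : upset T -> (0 < j)%N ->
  (forall w, T w -> (w x < j)%N -> T (zero_out x w)) ->
  (forall w, T w -> (w y < j)%N -> T (zero_out y w)) ->
  (forall w, (j <= w x)%N -> (j <= w y)%N -> T w) ->
  DT k (fun w => T w \/ (0 < w x)%N) -> DT k (fun w => T w \/ (0 < w y)%N) -> DT k T.
Proof.
move=> uT j0 Hx Hy Hxy; move=> /(depth_power_var k uT j0 Hx) Dx /(depth_power_var k uT j0 Hy) Dy.
apply: (@depth_colon_adjoin _ mx (max_ideal R n) (@mpoly_noetherian R n) _ _ 'X_[U_(x) *+ j]).
- exact: mono_is_ideal.
- have := depth_mono_colon (U_(x) *+ j)%MM (upset_or uT (@upset_ge y j)) Dy.
  rewrite colon_mono; rewrite (mono_ideal_ext (T' := fun w => T (w + U_(x) *+ j)%MM)) //.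
  move=> w; split=> [[] // yw|]; last by left.
  by apply: Hxy; rewrite // mnmDE mulmnE mnm1E eqxx mul1n leq_addl.
rewrite adjoin_mono // (mono_ideal_ext (T' := fun w => T w \/ (j <= w x)%N)) // => w.
by rewrite lemX.
Qed.

(** The variables outside [s] form a regular sequence. *)
Lemma depth_free (s : seq 'I_n) :
  uniq s -> DT (n - size s) (fun w => has (fun v => 0 < w v)%N s).
Proof.
move: {2}(n - size s)%N (erefl (n - size s)%N) => d; elim: d s => [|d IH] s ds us; first by rewrite ds.
have [x xs] : exists x, x \notin s.
  apply/existsP; apply: contraPT ds => /existsPn E.
  suff -> : size s = n by rewrite subnn.
  rewrite -[RHS]card_ord -(card_uniqP us); apply: eq_card => x.
  by rewrite [RHS]inE; apply/negPn/E.
rewrite ds; exists 'X_x; split; first exact: max_idealX.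
  apply: nzd_mono => w; congr is_true; apply: eq_in_has => v vs; rewrite mnmDE mnm1E.
  by case: eqP => [E|]; [rewrite E vs in xs|rewrite addn0].
have := IH (x :: s); rewrite /= xs us /= subnS ds => /(_ erefl erefl).
rewrite adjoin_mono; last first.
  move=> u w /mnm_lepP uw /hasP [v vs uv]; apply/hasP; exists v => //.
  exact: leq_trans uv (uw v).
rewrite (mono_ideal_ext (T' := fun w => has (fun v => 0 < w v)%N s \/ (U_(x) <= w)%MM)) //.
by move=> w; rewrite lep1mP -lt0n; split=> [/orP []|[|]->]; rewrite ?orbT; auto.
Qed.

Lemma max_ideal_pow f k w : mx f -> (f ^+ k)@_w != 0 -> (k <= mdeg w)%N.
Proof.
move=> mf; elim: k w => [//|k IH] w; rewrite exprS => /mcoeffM_supp [u [v [fu fv ->]]].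
rewrite mdegD -add1n leq_add ?IH // lt0n mdeg_eq0.
by apply: contraNneq fu => ->; rewrite mf.
Qed.

(** If [k > n], positive depth would remain after adjoining all [n] variables; but modulo the
    maximal ideal 1 is a socle element. *)
Lemma depth_maximal T k : upset T -> ~ T 0%MM -> DT k T -> (k <= n)%N.
Proof.
move=> uT T0 DT; rewrite leqNgt; apply/negP => nk.
have /(_ (enum 'I_n)) := depth_mono_adjoin _ uT DT; rewrite size_enum_ord.
rewrite -(subnSK nk) => /depth_socle_free /(_ 1) H.
suff : mono_ideal (fun w => T w \/ has (fun v => 0 < w v)%N (enum 'I_n)) 1.
  move=> /(_ 0%MM); rewrite mcoeff1 eqxx oner_neq0 => /(_ isT) [//|/hasP [v _]].
  by rewrite mnm0E.
apply: H => a ma w; rewrite mulr1 => aw; right.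
have : w != 0%MM by apply: contraNneq aw => ->; rewrite ma.
apply: contraR => /hasPn E; apply/eqP/mnmP => i; rewrite mnm0E; apply/eqP.
by rewrite -leqn0 leqNgt; apply: E; rewrite mem_enum.
Qed.

(** * Disconnected punctured spectra *)

Section Disconnected.
Variables (T : M -> Prop) (Xs Ys : pred 'I_n) (K : nat) (x0 y0 : 'I_n).
Hypotheses (uT : upset T)
  (HK : forall v, T (U_(v) *+ K)%MM \/ (Xs v || Ys v))
  (HXY : forall x y, Xs x -> Ys y -> T (U_(x) *+ K + U_(y) *+ K)%MM)
  (Xx0 : Xs x0) (Yy0 : Ys y0)
  (nx0 : forall k, ~ T (U_(x0) *+ k)%MM) (ny0 : forall k, ~ T (U_(y0) *+ k)%MM).

Let TX w := [exists x, Xs x && (K <= w x)%N].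
Let TY w := [exists y, Ys y && (K <= w y)%N].

Lemma disconnected_split p : (forall w, p@_w != 0 -> exists v, (K <= w v)%N) ->
  exists a b, [/\ mono_ideal TX a, mono_ideal TY b & mono_ideal T (p - (a + b))].
Proof.
move=> Hp; exists (mfilter TX p), (mfilter (fun w => ~~ TX w && TY w) p); split=> w.
- by rewrite mcoeff_mfilter; case: ifP => //; rewrite eqxx.
- by rewrite mcoeff_mfilter; case: ifP => [/andP []|] //; rewrite eqxx.
rewrite mcoeffB mcoeffD !mcoeff_mfilter; case: ifPn => /= nX; first by rewrite addr0 subrr eqxx.
case: ifPn => nY; first by rewrite add0r subrr eqxx.
rewrite addr0 subr0 => /Hp [v Kv]; have [Tv|/orP [Xv|Yv]] := HK v.
- by apply: uT Tv; rewrite lemX.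
- by case/existsP: nX; exists v; rewrite Xv.
- by case/existsP: nY; exists v; rewrite Yv.
Qed.

Lemma disconnected_mul a b : mono_ideal TX a -> mono_ideal TY b -> mono_ideal T (a * b).
Proof.
move=> Ha Hb w /mcoeffM_supp [u [v [/Ha /existsP [x /andP [Xx xu]] /Hb /existsP [y /andP [Yy yv]] ->]]].
apply: uT (HXY Xx Yy); apply/mnm_lepP => i; rewrite !mnmDE leq_add //.
  by move: i; apply/mnm_lepP; rewrite lemX.
by move: i; apply/mnm_lepP; rewrite lemX.
Qed.

(* Hartshorne's connectedness theorem in the case at hand: writing [f ^ N = a + b] and
   [g ^ N = a' + b'] modulo [T], with [a, a'] in [(x ^ K : x in Xs)] and [b, b'] in
   [(y ^ K : y in Ys)], a regular sequence [f, g] would give [a = h * f ^ N] modulo [T]; then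
   [h * y0 ^ K] and [(1 - h) * x0 ^ K] lie in [T], although [h] or [1 - h] has nonzero constant term. *)
Lemma disconnected_depth : ~ DT 2 T.
Proof.
move=> D2; have IT := mono_is_ideal uT; have mI := max_ideal R n.
have npos : (0 < n)%N by case: (n) x0 => [|//] [].
(* Pigeonhole: a monomial of degree at least [N] has some exponent at least [K]. *)
pose N := (n * K)%N.+1.
have Hpow f : mx f -> exists a b, [/\ mono_ideal TX a, mono_ideal TY b & mono_ideal T (f ^+ N - (a + b))].
  move=> mf; apply: disconnected_split => w /(max_ideal_pow mf) Nw; apply/existsP.
  apply: contraLR Nw => /existsPn E; rewrite -ltnNge mdegE ltnS -[X in (_ <= X * _)%N]card_ord -sum_nat_const.
  by apply: leq_sum => i _; rewrite ltnW // ltnNge E.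
have [f [mf Hf _]] := D2; have HF := nzdX (k := N) Hf.
have mF : mx (f ^+ N) by rewrite exprS; apply: ideal_mulr.
have [g [mg /(nzdX (k := N)) HG _]] := depth_adjoin mI (@mpoly_noetherian R n) IT D2 mF HF.
have [a [b [Ha Hb Hab]]] := Hpow f mf; have [a' [b' [Ha' Hb' Hab']]] := Hpow g mg.
move: HF HG Hab Hab'; set F := f ^+ N; set G := g ^+ N => HF HG Hab Hab'.
(* Modulo [T], both [G * a] and [a' * F] equal [a * a'], since products of an element of [TX] and
   one of [TY] vanish. *)
have [h Hh] : adjoin (mono_ideal T) F a.
  apply: HG; exists a'.
  rewrite (_ : G * a - a' * F =
    (G - (a' + b')) * a - (F - (a + b)) * a' + a * b' - a' * b); last by ring.
  apply: (idealB IT); rewrite //; last exact: disconnected_mul.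
  apply: (idealD IT); rewrite //; last exact: disconnected_mul.
  by apply: (idealB IT); apply: (ideal_mulr _ IT).
have TXx : mono_ideal TX 'X_[U_(x0) *+ K].
  by apply: mem_monoX; apply/existsP; exists x0; rewrite Xx0 mulmnE mnm1E eqxx mul1n leqnn.
have TYy : mono_ideal TY 'X_[U_(y0) *+ K].
  by apply: mem_monoX; apply/existsP; exists y0; rewrite Yy0 mulmnE mnm1E eqxx mul1n leqnn.
have hY : mono_ideal T (h * 'X_[U_(y0) *+ K]).
  apply: HF; rewrite (_ : F * (h * 'X_[U_(y0) *+ K]) =
    a * 'X_[U_(y0) *+ K] - (a - h * F) * 'X_[U_(y0) *+ K]); last by ring.
  by apply: (idealB IT); rewrite //; [apply: disconnected_mul|apply: (ideal_mulr _ IT)].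
have hX : mono_ideal T ((1 - h) * 'X_[U_(x0) *+ K]).
  apply: HF; rewrite (_ : F * ((1 - h) * 'X_[U_(x0) *+ K]) =
    'X_[U_(x0) *+ K] * b + ((F - (a + b)) + (a - h * F)) * 'X_[U_(x0) *+ K]); last by ring.
  apply: (idealD IT); rewrite //; first exact: disconnected_mul.
  by apply: (ideal_mulr _ IT); apply: (idealD IT).
have [h0|h0] := eqVneq h@_0%MM 0.
  apply: (@nx0 K); apply: hX; have := mcoeffMX (1 - h) (U_(x0) *+ K)%MM 0%MM.
  by rewrite addm0 => ->; rewrite mcoeffB h0 subr0 mcoeff1 eqxx oner_neq0.
by apply: (@ny0 K); apply: hY; have := mcoeffMX h (U_(y0) *+ K)%MM 0%MM; rewrite addm0 => ->.
Qed.

End Disconnected.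
End Monomial.

(** * Corners of the diagram *)

Section Corners.
Variables (r c : nat) (bx : 'I_r -> 'I_c -> bool) (w : 'I_r -> 'I_c -> nat).
Implicit Types (A : {set 'I_r}) (B : {set 'I_c}) (a : 'I_r -> nat) (b : 'I_c -> nat).

(** Says that [x ^ a * y ^ b], over the rows [A] and columns [B], lies outside the filling ideal. *)
Definition conflict_free A B a b :=
  forall i j, i \in A -> j \in B -> bx i j -> (a i < w i j)%N || (b j < w i j)%N.

(** For a conflict-free pair, row [i] is alive when no power of [x_i] moves [x ^ a * y ^ b] into the
    ideal. Alive columns are obtained by transposition. *)
Definition alive A B b := [set i in A | [forall j in B, bx i j ==> (b j < w i j)%N]].

Lemma aliveP A B b i :
  reflect (i \in A /\ forall j, j \in B -> bx i j -> (b j < w i j)%N) (i \in alive A B b).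
Proof.
rewrite inE; apply: (iffP andP) => -[-> H]; split=> //.
  by move=> j jB; apply/implyP; apply: (forall_inP H).
by apply/forall_inP => j jB; apply/implyP; apply: H.
Qed.

End Corners.

Definition above n (S : {set 'I_n}) (i : nat) := [set p in S | (i < p)%N].

Lemma in_above n (S : {set 'I_n}) i p : (p \in above S i) = (p \in S) && (i < p)%N.
Proof. by rewrite in_set. Qed.

Lemma leq_above n (S S' : {set 'I_n}) (i i' : nat) :
  (forall p, p \in S -> (i < p)%N -> p \in S' /\ (i' < p)%N) -> (#|above S i| <= #|above S' i'|)%N.
Proof.
move=> H; apply: subset_leq_card; apply/subsetP => p; rewrite !in_above => /andP [pS ip].
by have [-> ->] := H p pS ip.
Qed.

Definition tr (r c : nat) (T : Type) (f : 'I_r -> 'I_c -> T) j i := f i j.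

(* For [f = x ^ a * y ^ b] outside [I(Y)], the ideal [sqrt (I(Y) : f)] is generated by the dead
   variables and by the edge ideal of the Ferrers graph induced on the alive rows and columns;
   [corner_bound] bounds [k] by the depths of these radicals, one corner at a time. *)
Definition corner_bound (r c : nat) (bx : 'I_r -> 'I_c -> bool) (w : 'I_r -> 'I_c -> nat)
    (A : {set 'I_r}) (B : {set 'I_c}) (k : nat) :=
  forall (a : 'I_r -> nat) (b : 'I_c -> nat) (i : 'I_r) (j : 'I_c), conflict_free bx w A B a b ->
    i \in alive bx w A B b -> j \in alive (tr bx) (tr w) B A a -> bx i j ->
    (k <= #|above (alive bx w A B b) i| +
          #|above (alive (tr bx) (tr w) B A a) j| + 1)%N.

(** The second clause covers the case without boxes, where there are no corners and the ideal is
    generated by variables. *)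
Definition depth_bound (r c : nat) (bx : 'I_r -> 'I_c -> bool) (w : 'I_r -> 'I_c -> nat)
    (A : {set 'I_r}) (B : {set 'I_c}) (k : nat) :=
  corner_bound bx w A B k /\
  ((forall i j, i \in A -> j \in B -> ~~ bx i j) -> (k <= #|A| + #|B|)%N).

Lemma corner_bound_tr r c (bx : 'I_r -> 'I_c -> bool) w A B k :
  corner_bound bx w A B k -> corner_bound (tr bx) (tr w) B A k.
Proof.
move=> H b a j i cf jC iR bij; rewrite [X in (X + _)%N]addnC; apply: H => //.
by move=> p q pA qB bpq; rewrite orbC; apply: cf.
Qed.

Lemma depth_bound_tr r c (bx : 'I_r -> 'I_c -> bool) w A B k :
  depth_bound bx w A B k -> depth_bound (tr bx) (tr w) B A k.
Proof.
case=> H H0; split; first exact: corner_bound_tr.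
by move=> nb; rewrite addnC; apply: H0 => i j iA jB; apply: nb.
Qed.

Lemma leq_above_alive r c (bx : 'I_r -> 'I_c -> bool) w (A : {set 'I_r}) (B : {set 'I_c}) b g : g \in A ->
  (#|above (alive bx w A B b) g| <= #|A :\ g|)%N.
Proof.
move=> gA; apply: subset_leq_card; apply/subsetP => p.
rewrite in_above => /andP [/aliveP [pA _] gp].
by rewrite in_setD1 pA andbT -val_eqE neq_ltn gp orbT.
Qed.

(** * Deleting the row of a minimal box *)

Section DeleteRow.
Variables (r c : nat) (bx : 'I_r -> 'I_c -> bool) (w : 'I_r -> 'I_c -> nat).
Hypothesis down : forall (i i' : 'I_r) (j j' : 'I_c), bx i j -> (i' <= i)%N -> (j' <= j)%N -> bx i' j'.
Hypothesis wpos : forall i j, bx i j -> (0 < w i j)%N.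

(** Each corner [(i, j)] for the rows without [g] is matched with a corner for all rows whose bound
    is no larger. The difficulty is an alive row [g] with [i < g], which would be counted among the
    rows above [i]. *)
Lemma depth_bound_delete_row (A : {set 'I_r}) (B : {set 'I_c}) g d k :
  g \in A -> d \in B -> bx g d ->
  (forall i, i \in A -> (i < g)%N -> (w g d < w i d)%N) ->
  corner_bound bx w A B k -> depth_bound bx w (A :\ g) B k.
Proof.
move=> gA dB bgd north H.
have sub_alive b : alive bx w (A :\ g) B b \subset alive bx w A B b.
  apply/subsetP => p /aliveP [pA Hp]; apply/aliveP; split=> //.
  by move: pA; rewrite in_setD1 => /andP [].
split=> [a b i j cf iR jC bij|nobox]; last first.
  have cA := leq_above_alive bx w B (fun=> 0%N) gA.
  have cB := leq_above_alive (tr bx) (tr w) A (fun=> 0%N) dB.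
  (* When no box is left, the corner [(g, d)] for the monomial 1 gives the bound. *)
  apply: leq_trans (H (fun=> 0%N) (fun=> 0%N) g d _ _ _ bgd) _.
  - by move=> p q _ _ bpq; rewrite wpos.
  - by apply/aliveP; split=> // q _; apply: wpos.
  - by apply/aliveP; split=> // p _; apply: wpos.
  by rewrite -addnA leq_add // (cardsD1 d B) dB addnC leq_add2l.
have [iA Hi] := aliveP _ _ _ _ _ _ iR; have [jB Hj] := aliveP _ _ _ _ _ _ jC.
move: iA; rewrite in_setD1 => /andP [ig iA].
(* Exponent 0 at row [g] kills no column, as the values are positive. *)
pose a0 p := if p == g then 0%N else a p.
have inA' p : p \in A -> p != g -> p \in A :\ g by rewrite in_setD1 => -> ->.
have cf0 : conflict_free bx w A B a0 b.
  move=> p q pA qB bpq; rewrite /a0; case: eqVneq => [_|pg]; first by rewrite wpos.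
  by apply: cf => //; apply: inA'.
have iR0 : i \in alive bx w A B b by apply: (subsetP (sub_alive b)).
have C0 : alive (tr bx) (tr w) B A a0 = alive (tr bx) (tr w) B (A :\ g) a.
  apply/setP => q; apply/aliveP/aliveP => -[qB Hq]; split=> // p.
    by rewrite in_setD1 => /andP [pg pA] bpq; have := Hq p pA bpq; rewrite /a0 (negbTE pg).
  move=> pA bpq; rewrite /a0; case: eqVneq => [_|pg]; first exact: wpos.
  by apply: Hq => //; apply: inA'.
have jC0 : j \in alive (tr bx) (tr w) B A a0 by rewrite C0.
have alive' p : p \in alive bx w A B b -> p != g -> p \in alive bx w (A :\ g) B b.
  by case/aliveP => pA Hp pg; apply/aliveP; split=> //; apply: inA'.
case: (ltngtP i g) => [lig|lgi|/val_inj E]; last by rewrite E eqxx in ig.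
  case: (boolP (g \in alive bx w A B b)) => [gR|gR]; last first.
    apply: leq_trans (H a0 b i j cf0 iR0 jC0 bij) _; rewrite C0 !leq_add2r.
    apply: leq_above => p pR ip; split=> //; apply: alive' => //.
    by apply: contraNneq gR => <-.
  have [_ Hg] := aliveP _ _ _ _ _ _ gR.
  case: (boolP (bx g j)) => [bgj|nbgj].
    (* The corner moves to [(g, j)], beyond which lie no more rows than beyond [i] without [g]. *)
    apply: leq_trans (H a0 b g j cf0 gR jC0 bgj) _; rewrite C0 !leq_add2r.
    apply: leq_above => p pR gp; split; last exact: ltn_trans gp.
    by apply: alive' => //; rewrite -val_eqE neq_ltn gp orbT.
  (* Without a box [(g, j)], the rows from [g] on do not meet the columns from [j] on, so their
     exponents can be 0. Then [b d] can be raised to [w g d]: this kills row [g], while alive rows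
     before [g] stay alive by [north]. *)
  pose a1 (p : 'I_r) := if (p < g)%N then a p else 0%N.
  pose b1 q := if q == d then w g d else b q.
  have Hd p : p \in A -> (p < g)%N -> bx p d -> (b1 d < w p d)%N.
    by rewrite /b1 eqxx => pA pg _; apply: north.
  have neg (p : 'I_r) : (p < g)%N -> p != g by move=> pg; rewrite -val_eqE neq_ltn pg.
  have sub1 p : p \in alive bx w A B b1 -> p \in alive bx w (A :\ g) B b.
    case/aliveP => pA Hp; apply/aliveP; have [pdb|npdb] := boolP (bx p d).
      have := Hp d dB pdb; rewrite {1}/b1 eqxx => gp.
      have pg : p != g by apply: contraTneq gp => ->; rewrite ltnn.
      split=> [|q qB bpq]; first exact: inA'.
      have := Hp q qB bpq; rewrite /b1; case: eqP => // -> _.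
      by apply: ltn_trans gp; apply: Hg.
    split=> [|q qB bpq]; first by apply: inA' => //; apply: contraNneq npdb => ->.
    have := Hp q qB bpq; rewrite /b1; case: eqP => // E.
    by rewrite -E bpq in npdb.
  have Cj (q : 'I_c) : (j <= q)%N -> q \in alive (tr bx) (tr w) B A a1 <-> q \in alive (tr bx) (tr w) B (A :\ g) a.
    move=> jq; split=> /aliveP [qB Hq]; apply/aliveP; split=> // p.
      rewrite in_setD1 => /andP [pg pA] bpq; have := Hq p pA bpq; rewrite /a1.
      case: (ltnP p g) => // gp; case/negP: nbgj; exact: (@down p g q j).
    move=> pA bpq; rewrite /a1; case: (ltnP p g) => [pg|_]; last exact: wpos.
    by apply: Hq => //; apply/inA'/neg.
  apply: leq_trans (H a1 b1 i j _ _ _ bij) _.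
  - move=> p q pA qB bpq; rewrite /a1; case: (ltnP p g) => [pg|_]; last by rewrite wpos.
    have [Eq|nqd] := eqVneq q d; first by rewrite Eq Hd ?orbT // -Eq.
    by rewrite /b1 (negbTE nqd); apply: cf => //; apply/inA'/neg.
  - apply/aliveP; split=> // q qB biq; have [Eq|nqd] := eqVneq q d; first by rewrite Eq Hd // -Eq.
    by rewrite /b1 (negbTE nqd); apply: Hi.
  - exact/(Cj j (leqnn j)).
  rewrite leq_add2r leq_add //; apply: leq_above => p pR ip; split=> //; first exact: sub1.
  by apply/Cj; rewrite // ltnW.
apply: leq_trans (H a0 b i j cf0 iR0 jC0 bij) _; rewrite C0 !leq_add2r.
apply: leq_above => p pR ip; split=> //; apply: alive' => //.
by rewrite -val_eqE neq_ltn (ltn_trans lgi ip) orbT.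
Qed.

End DeleteRow.

(** * Depth of filling ideals *)

Section Filling.
Variables (R : fieldType) (r c : nat) (bx : 'I_r -> 'I_c -> bool) (w : 'I_r -> 'I_c -> nat).
Hypothesis wpos : forall i j, bx i j -> (0 < w i j)%N.
Local Notation M := 'X_{1..r + c}.
Local Notation DT k T := (depth_ge (@in_max_ideal R (r + c)) k (mono_ideal T)).
Implicit Types (A : {set 'I_r}) (B : {set 'I_c}) (m u : M).

(* Monomials of [I(Y) + (x_i : i \notin A) + (y_j : j \notin B)]. *)
Definition filling_mono A B m : Prop :=
  [\/ exists2 i, i \notin A & (0 < m (lshift c i))%N,
      exists2 j, j \notin B & (0 < m (rshift r j))%N |
      exists i j, [/\ i \in A, j \in B, bx i j,
        (w i j <= m (lshift c i))%N & (w i j <= m (rshift r j))%N]].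

Lemma filling_upset A B : upset (filling_mono A B).
Proof.
move=> u v /mnm_lepP uv [[i iA Hi]|[j jB Hj]|[i [j [iA jB bij Hi Hj]]]].
- by apply: Or31; exists i => //; apply: leq_trans (uv _).
- by apply: Or32; exists j => //; apply: leq_trans (uv _).
- by apply: Or33; exists i, j; split=> //; apply: leq_trans (uv _).
Qed.

Lemma filling_delete_row A B g m : g \in A ->
  filling_mono A B m \/ (0 < m (lshift c g))%N <-> filling_mono (A :\ g) B m.
Proof.
move=> gA; split.
  case=> [[[i iA Hi]|H|[i [j [iA jB bij Hi Hj]]]]|Hg]; last by apply: Or31; exists g; rewrite ?setD11.
  - by apply: Or31; exists i => //; rewrite in_setD1 negb_and iA orbT.
  - exact: Or32.
  have [E|ig] := eqVneq i g.
    by apply: Or31; exists g; rewrite ?setD11 // -E; apply: leq_trans Hi; apply: wpos.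
  by apply: Or33; exists i, j; split=> //; rewrite in_setD1 ig.
case=> [[i]|H|[i [j [+ jB bij Hi Hj]]]].
- rewrite in_setD1 negb_and negbK => /orP [/eqP -> Hg|iA Hi]; first by right.
  by left; apply: Or31; exists i.
- by left; apply: Or32.
rewrite in_setD1 => /andP [_ iA]; left; apply: Or33; exists i, j; split=> //.
Qed.

Lemma filling_delete_col A B d m : d \in B ->
  filling_mono A B m \/ (0 < m (rshift r d))%N <-> filling_mono A (B :\ d) m.
Proof.
move=> dB; split.
  case=> [[H|[j jB Hj]|[i [j [iA jB bij Hi Hj]]]]|Hd]; last by apply: Or32; exists d; rewrite ?setD11.
  - exact: Or31.
  - by apply: Or32; exists j => //; rewrite in_setD1 negb_and jB orbT.
  have [E|jd] := eqVneq j d.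
    by apply: Or32; exists d; rewrite ?setD11 // -E; apply: leq_trans Hj; apply: wpos.
  by apply: Or33; exists i, j; split=> //; rewrite in_setD1 jd.
case=> [H|[j]|[i [j [iA + bij Hi Hj]]]].
- by left; apply: Or31.
- rewrite in_setD1 negb_and negbK => /orP [/eqP -> Hd|jB Hj]; first by right.
  by left; apply: Or32; exists j.
rewrite in_setD1 => /andP [_ jB]; left; apply: Or33; exists i, j; split=> //.
Qed.

(** As [w g d] is minimal, a monomial of the ideal with exponent of [x_g] below [w g d] does not owe
    its membership to row [g], so [x_g] can be removed from it; likewise for [y_d]. *)
Lemma depth_of_deletions A B g d k : g \in A -> d \in B -> bx g d ->
  (forall i j, i \in A -> j \in B -> bx i j -> (w g d <= w i j)%N) ->
  DT k (filling_mono (A :\ g) B) -> DT k (filling_mono A (B :\ d)) -> DT k (filling_mono A B).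
Proof.
move=> gA dB bgd Hmin Dg Dd.
have zr (x : 'I_(r + c)) m i : lshift c i != x -> zero_out x m (lshift c i) = m (lshift c i).
  by move=> /negbTE ix; rewrite mnmE ix.
have zc (x : 'I_(r + c)) m j : rshift r j != x -> zero_out x m (rshift r j) = m (rshift r j).
  by move=> /negbTE ix; rewrite mnmE ix.
apply: (@depth_ge_of_adjoin_vars R _ k _ (lshift c g) (rshift r d) (w g d) (@filling_upset A B)).
- exact: wpos.
- move=> m [[i iA Hi]|[j jB Hj]|[i [j [iA jB bij Hi Hj]]]] mg.
  + apply: Or31; exists i => //; rewrite zr // eq_lshift.
    by apply: contraNneq iA => ->.
  + by apply: Or32; exists j => //; rewrite zc // eq_rlshift.
  + apply: Or33; exists i, j; split=> //; last by rewrite zc // eq_rlshift.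
    rewrite zr // eq_lshift; apply: contraTneq mg => E; rewrite -leqNgt -[in leqRHS]E.
    by apply: leq_trans Hi; apply: Hmin.
- move=> m [[i iA Hi]|[j jB Hj]|[i [j [iA jB bij Hi Hj]]]] mg.
  + by apply: Or31; exists i => //; rewrite zr // eq_lrshift.
  + apply: Or32; exists j => //; rewrite zc // eq_rshift.
    by apply: contraNneq jB => ->.
  + apply: Or33; exists i, j; split=> //; first by rewrite zr // eq_lrshift.
    rewrite zc // eq_rshift; apply: contraTneq mg => E; rewrite -leqNgt -[in leqRHS]E.
    by apply: leq_trans Hj; apply: Hmin.
- by move=> m mg md; apply: Or33; exists g, d.
- by rewrite (mono_ideal_ext R (fun m => filling_delete_row B m gA)).
- by rewrite (mono_ideal_ext R (fun m => filling_delete_col A m dB)).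
Qed.

Lemma exists_minimal_box A B i0 j0 : i0 \in A -> j0 \in B -> bx i0 j0 ->
  exists g d, [/\ g \in A, d \in B, bx g d,
    (forall i j, i \in A -> j \in B -> bx i j -> (w g d <= w i j)%N) &
    (forall i j, i \in A -> j \in B -> bx i j -> (i <= g)%N -> (j <= d)%N ->
      (i, j) <> (g, d) -> (w g d < w i j)%N)].
Proof.
(* Minimising [key] minimises the value first and [i + j] second, because [i + j < r + c]. *)
move=> iA jB bij; pose key (t : 'I_r * 'I_c) := (w t.1 t.2 * (r + c) + (t.1 + t.2))%N.
pose ok (t : 'I_r * 'I_c) := [&& t.1 \in A, t.2 \in B & bx t.1 t.2].
have ok0 : ok (i0, j0) by rewrite /ok /= iA jB.
have [[g d] /and3P [/= gA dB bgd] Hmin] := arg_minnP key ok0.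
have Hkey i j : i \in A -> j \in B -> bx i j -> (key (g, d) <= key (i, j))%N.
  by move=> *; apply: Hmin; apply/and3P.
have le_w i j : i \in A -> j \in B -> bx i j -> (w g d <= w i j)%N.
  move=> iA' jB' bij'; have := Hkey i j iA' jB' bij'; rewrite /key /= => le.
  rewrite leqNgt; apply/negP => lt.
  have := leq_mul lt (leqnn (r + c)); have := ltn_ord i; have := ltn_ord j; lia.
exists g, d; split=> // i j iA' jB' bij' ig jd ne.
rewrite ltn_neqAle le_w // andbT; apply/eqP => E; apply: ne.
have := Hkey i j iA' jB' bij'; rewrite /key /= E leq_add2l => le.
by congr (_, _); apply: val_inj => /=; lia.
Qed.

Lemma depth_no_box A B : (forall i j, i \in A -> j \in B -> ~~ bx i j) ->
  DT (#|A| + #|B|) (filling_mono A B).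
Proof.
move=> nb; pose s := map (@lshift r c) (enum (~: A)) ++ map (@rshift r c) (enum (~: B)).
have us : uniq s.
  rewrite cat_uniq !map_inj_uniq ?enum_uniq /= ?andbT; first last.
  - exact: lshift_inj.
  - exact: rshift_inj.
  by apply/hasPn => _ /mapP [j _ ->]; apply/mapP => -[i _] /eqP; rewrite eq_rlshift.
have := depth_free R us; rewrite size_cat !size_map -!cardE.
have := cardsC A; have := cardsC B; rewrite !card_ord => EB EA.
rewrite (_ : r + c - _ = #|A| + #|B|)%N; last first.
  by rewrite -[X in (X + _ - _)%N]EA -[X in (_ + X - _)%N]EB addnACA addnK.
rewrite (mono_ideal_ext R (T' := filling_mono A B)) // => m; rewrite has_cat; split.
  case/orP => /hasP [v /mapP [i]]; rewrite mem_enum in_setC => iA -> Hi.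
    by apply: Or31; exists i.
  by apply: Or32; exists i.
case=> [[i iA Hi]|[j jB Hj]|[i [j [iA jB bij _ _]]]].
- by apply/orP; left; apply/hasP; exists (lshift c i) => //; rewrite map_f // mem_enum in_setC.
- by apply/orP; right; apply/hasP; exists (rshift r j) => //; rewrite map_f // mem_enum in_setC.
- by move: (nb i j iA jB); rewrite bij.
Qed.
End Filling.

(** * Depth in terms of corner bounds *)

Section Formula.
Variables (R : fieldType) (r c : nat) (bx : 'I_r -> 'I_c -> bool) (w : 'I_r -> 'I_c -> nat).
Hypothesis down : forall (i i' : 'I_r) (j j' : 'I_c),
  bx i j -> (i' <= i)%N -> (j' <= j)%N -> bx i' j'.
Hypothesis wpos : forall i j, bx i j -> (0 < w i j)%N.
Local Notation M := 'X_{1..r + c}.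
Local Notation DT k T := (depth_ge (@in_max_ideal R (r + c)) k (mono_ideal T)).
Implicit Types (A : {set 'I_r}) (B : {set 'I_c}) (m u : M).

Lemma depth_bound_delete_col A B g d k :
  g \in A -> d \in B -> bx g d ->
  (forall j, j \in B -> (j < d)%N -> (w g d < w g j)%N) ->
  corner_bound bx w A B k -> depth_bound bx w A (B :\ d) k.
Proof.
move=> gA dB bgd west H; apply: (@depth_bound_tr _ _ (tr bx) (tr w)).
apply: (@depth_bound_delete_row _ _ (tr bx) (tr w) _ _ B A d g k) => //.
- by move=> j j' i i' bij jj ii; apply: down bij ii jj.
- by move=> j i; apply: wpos.
- exact: corner_bound_tr.
Qed.

(** Induction on the number of rows and columns: at a minimal box, the bounds pass to the deletions
    of its row and of its column, and [depth_of_deletions] recombines the depths. *)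
Lemma depth_sufficient A B k : depth_bound bx w A B k -> DT k (filling_mono bx w A B).
Proof.
move: {2}(#|A| + #|B|)%N (leqnn (#|A| + #|B|)) => s; elim: s A B => [|s IH] A B sAB [H H0].
  apply: depth_geW (depth_no_box R _ _) => [|i j iA jB]; last first.
    by move: sAB; rewrite (cardsD1 i) iA.
  apply: H0 => i j iA jB; by move: sAB; rewrite (cardsD1 i) iA.
case: (classic (exists i j, [/\ i \in A, j \in B & bx i j])) => [[i0 [j0 [iA jB bij]]]|nb]; last first.
  have {}nb i j : i \in A -> j \in B -> ~~ bx i j.
    by move=> iA jB; apply/negP => bij; apply: nb; exists i, j.
  by apply: depth_geW (depth_no_box R _ nb); apply: H0.
have [g [d [gA dB bgd Hmin Hnw]]] := exists_minimal_box w iA jB bij.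
apply: (depth_of_deletions wpos gA dB bgd Hmin); apply: IH.
- by move: sAB; rewrite (cardsD1 g) gA.
- apply: (depth_bound_delete_row down wpos gA dB bgd) => // i iA' ig.
  apply: Hnw => //; [exact: down bgd (ltnW ig) _|exact: ltnW|].
  by case=> E; rewrite E ltnn in ig.
- by move: sAB; rewrite (cardsD1 d B) dB addnCA.
- apply: (depth_bound_delete_col gA dB bgd) => // j jB' jd.
  apply: Hnw => //; [exact: down bgd _ (ltnW jd)|exact: ltnW|].
  by case=> E; rewrite E ltnn in jd.
Qed.

(** The colon by [x ^ a * y ^ b] does not lower the depth, and each alive variable beyond the corner
    costs at most one. If the bound failed, depth 2 would remain, against [disconnected_depth]. *)
Lemma depth_necessary A B k : DT k (filling_mono bx w A B) -> corner_bound bx w A B k.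
Proof.
move=> D a b i j cf iR jC bij.
have [iA Hi] := aliveP _ _ _ _ _ _ iR; have [jB Hj] := aliveP _ _ _ _ _ _ jC.
(* Exponents outside [A] and [B] are set to 0, as [a] and [b] are arbitrary there. *)
pose u : M := [multinom match split v with
  | inl p => if p \in A then a p else 0%N
  | inr q => if q \in B then b q else 0%N end | v < r + c].
have ul p : u (lshift c p) = if p \in A then a p else 0%N.
  by rewrite mnmE (unsplitK (inl p)).
have ur q : u (rshift r q) = if q \in B then b q else 0%N.
  by rewrite mnmE (unsplitK (inr q)).
have uT := @filling_upset r c bx w A B.
have {}D := depth_mono_colon u uT D.
pose T1 m := filling_mono bx w A B (m + u)%MM; have uT1 : upset T1 by apply: upset_shift.
set RA := alive bx w A B b in iR *; set CB := alive (tr bx) (tr w) B A a in jC *.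
pose s := map (@lshift r c) (enum (above RA i)) ++ map (@rshift r c) (enum (above CB j)).
have {}D := depth_mono_adjoin s uT1 D.
have Es : size s = (#|above RA i| + #|above CB j|)%N by rewrite size_cat !size_map -!cardE.
rewrite -Es addn1 leqNgt; apply/negP => lt.
have {}D := depth_geW (l := 2) _ D; move: {D} (D ltac:(lia)).
have ls p : (lshift c p \in s) = (p \in above RA i).
  rewrite mem_cat mem_map ?mem_enum; last exact: lshift_inj.
  rewrite [X in _ || X](_ : _ = false) ?orbF //.
  by apply/mapP => -[q _] /eqP; rewrite eq_lrshift.
have rs q : (rshift r q \in s) = (q \in above CB j).
  rewrite mem_cat orbC mem_map ?mem_enum; last exact: rshift_inj.
  rewrite [X in _ || X](_ : _ = false) ?orbF //.
  by apply/mapP => -[p _] /eqP; rewrite eq_rlshift.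
(* [K] is at least every value of the filling, so [K]-th powers suffice for the memberships
   below. *)
pose K := (\sum_p \sum_q w p q).+1.
have wK p q : (w p q <= K)%N.
  by rewrite /K (bigD1 p) //= (bigD1 q) //= -!addnA; apply/leqW/leq_addr.
(* The two components are the alive rows up to [i] and the alive columns up to [j]; since [(i, j)]
   is a box, any such row and column meet in a box. *)
pose X0 v := [exists p : 'I_r, [&& v == lshift c p, p \in RA & (p <= i)%N]].
pose Y0 v := [exists q : 'I_c, [&& v == rshift r q, q \in CB & (q <= j)%N]].
have Xl p k' : (U_(lshift c p) *+ k')%MM (lshift c p) = k'.
  by rewrite mulmnE mnm1E eqxx mul1n.
have Yl p k' : (U_(rshift r p) *+ k')%MM (rshift r p) = k'.
  by rewrite mulmnE mnm1E eqxx mul1n.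
apply: (@disconnected_depth R _ _ X0 Y0 K (lshift c i) (rshift r j)).
- apply: upset_or => // m m' /mnm_lepP mm' /hasP [v vs mv]; apply/hasP; exists v => //.
  exact: leq_trans mv (mm' v).
- move=> v; case: (split_ordP v) => p ->.
    have [pA|pA] := boolP (p \in A); last first.
      by left; left; apply: Or31; exists p; rewrite // mnmDE Xl.
    have [pR|pR] := boolP (p \in RA).
      have [pi|ip] := leqP p i.
        by right; apply/orP; left; apply/existsP; exists p; rewrite eqxx pR pi.
      left; right; apply/hasP; exists (lshift c p); last by rewrite Xl.
      by rewrite ls in_above pR.
    left; left; apply: Or33; exists p.
    move: pR; rewrite inE pA negb_forall => /existsP [q].
    rewrite !negb_imply -leqNgt => /and3P [qB bpq wb]; exists q; split=> //.
      by rewrite mnmDE Xl; apply: leq_trans (leq_addr _ _).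
    by rewrite mnmDE ur qB; apply: leq_trans (leq_addl _ _).
  have [pB|pB] := boolP (p \in B); last first.
    by left; left; apply: Or32; exists p; rewrite // mnmDE Yl.
  have [pR|pR] := boolP (p \in CB).
    have [pj|jp] := leqP p j.
      by right; apply/orP; right; apply/existsP; exists p; rewrite eqxx pR pj.
    left; right; apply/hasP; exists (rshift r p); last by rewrite Yl.
    by rewrite rs in_above pR.
  left; left; apply: Or33.
  move: pR; rewrite inE pB negb_forall => /existsP [q].
  rewrite !negb_imply -leqNgt => /and3P [qA bpq wb]; exists q, p; split=> //.
    by rewrite mnmDE ul qA; apply: leq_trans (leq_addl _ _).
  by rewrite mnmDE Yl; apply: leq_trans (leq_addr _ _).
- move=> _ _ /existsP [p /and3P [/eqP -> pR pi]] /existsP [q /and3P [/eqP -> qC qj]].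
  have [pA _] := aliveP _ _ _ _ _ _ pR; have [qB _] := aliveP _ _ _ _ _ _ qC.
  left; apply: Or33; exists p, q; split=> //.
  + exact: down bij pi qj.
  + by rewrite !mnmDE Xl -addnA; apply: leq_trans (leq_addr _ _).
  + by rewrite !mnmDE Yl -addnA addnCA; apply: leq_trans (leq_addr _ _).
- by apply/existsP; exists i; rewrite eqxx iR leqnn.
- by apply/existsP; exists j; rewrite eqxx jC leqnn.
- move=> k' [|/hasP [v vs]]; last first.
    rewrite mulmnE mnm1E; case: eqP => [E|_]; last by rewrite mul0n.
    by move: vs; rewrite -E ls in_above ltnn andbF.
  case=> [[p pA]|[q qB]|[p [q [pA qB bpq]]]].
  + rewrite mnmDE ul (negbTE pA) addn0 mulmnE mnm1E eq_lshift.
    by case: eqP => [E|_]; [rewrite -E iA in pA|rewrite mul0n].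
  + by rewrite mnmDE ur (negbTE qB) addn0 mulmnE mnm1E eq_lrshift mul0n.
  rewrite !mnmDE ul ur pA qB !mulmnE !mnm1E eq_lshift eq_lrshift mul0n add0n.
  case: eqP => [E|_] H1 H2; first by have := Hi q qB; rewrite E => /(_ bpq); lia.
  by have := cf p q pA qB bpq; lia.
- move=> k' [|/hasP [v vs]]; last first.
    rewrite mulmnE mnm1E; case: eqP => [E|_]; last by rewrite mul0n.
    by move: vs; rewrite -E rs in_above ltnn andbF.
  case=> [[p pA]|[q qB]|[p [q [pA qB bpq]]]].
  + by rewrite mnmDE ul (negbTE pA) addn0 mulmnE mnm1E eq_rlshift mul0n.
  + rewrite mnmDE ur (negbTE qB) addn0 mulmnE mnm1E eq_rshift.
    by case: eqP => [E|_]; [rewrite -E jB in qB|rewrite mul0n].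
  rewrite !mnmDE ul ur pA qB !mulmnE !mnm1E eq_rshift eq_rlshift mul0n add0n.
  case: eqP => [E|_] H1 H2; first by have := Hj p pA; rewrite E => /(_ bpq); rewrite /tr; lia.
  by have := cf p q pA qB bpq; lia.
Qed.

End Formula.

(** * Finitely generated ideals and regular sequences *)

Section Bridge.
Variables (R : fieldType) (n : nat).
Local Notation P := {mpoly R[n]}.
Local Notation mx := (@in_max_ideal R n).
Implicit Types (gs : seq P) (f g p : P).

Lemma in_ideal_rcons gs f : in_ideal (rcons gs f) = adjoin (in_ideal gs) f.
Proof.
apply: pred_ext => p; rewrite /adjoin /in_ideal; split=> [[cs ->]|[c [cs E]]].
  exists cs`_(size gs), cs; rewrite size_rcons big_ord_recr /= nth_rcons ltnn eqxx addrK.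
  by apply: eq_bigr => i _; rewrite nth_rcons ltn_ord.
(* A coefficient list may have any length, so it is cut or padded to put [c] exactly at index
   [size gs]. *)
exists (mkseq (fun i => if (i < size gs)%N then cs`_i else c) (size gs).+1).
rewrite size_rcons big_ord_recr /= nth_mkseq // ltnn nth_rcons ltnn eqxx.
rewrite -[p](subrK (c * f)) E; congr (_ + _); apply: eq_bigr => i _.
by rewrite nth_mkseq ?nth_rcons ?ltn_ord // ltnW // ltnS.
Qed.

Lemma in_ideal_nil p : in_ideal [::] p <-> p = 0.
Proof. by split=> [[cs ->]|->]; [rewrite big_ord0|exists [::]; rewrite big_ord0]. Qed.

Lemma in_ideal_ideal gs : is_ideal (in_ideal gs).
Proof.
elim/last_ind: gs => [|gs f IH]; last by rewrite in_ideal_rcons; apply: adjoin_ideal.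
split; first exact/in_ideal_nil.
  by move=> p q /in_ideal_nil -> /in_ideal_nil ->; apply/in_ideal_nil; rewrite addr0.
by move=> c p /in_ideal_nil ->; apply/in_ideal_nil; rewrite mulr0.
Qed.

Lemma in_ideal_gen gs g : g \in gs -> in_ideal gs g.
Proof.
elim/last_ind: gs => [//|gs f IH]; rewrite mem_rcons inE in_ideal_rcons => /predU1P [->|/IH].
  by rewrite -[X in adjoin _ _ X]mul1r; apply/mem_adjoin/in_ideal_ideal.
exact: sub_adjoin.
Qed.

Lemma in_ideal_min gs (J : P -> Prop) p : is_ideal J -> (forall g, g \in gs -> J g) ->
  in_ideal gs p -> J p.
Proof.
move=> IJ Hg [cs ->]; apply: ideal_sum => // i _; apply: idealM => //.
by apply/Hg/mem_nth.
Qed.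

Lemma in_ideal_mono gs (T : 'X_{1..n} -> Prop) : upset T ->
  (forall g, g \in gs -> exists2 u, g = 'X_[u] & T u) ->
  (forall m, T m -> exists2 u, 'X_[u] \in gs & (u <= m)%MM) ->
  in_ideal gs = mono_ideal T.
Proof.
move=> uT Hg Hm; apply: pred_ext => p; split.
  apply: in_ideal_min; first exact: mono_is_ideal.
  by move=> g /Hg [u -> Tu]; apply: mem_monoX.
move=> Hp; apply: mpoly_ideal_ind; first exact: in_ideal_ideal.
move=> m /Hp /Hm [u ugs um]; rewrite -(submK um) mpolyXD.
by apply: idealM; [exact: in_ideal_ideal|exact: in_ideal_gen].
Qed.

Lemma regular_seq_depth gs fs : is_regular_seq gs fs -> depth_ge mx (size fs) (in_ideal gs).
Proof.
elim: fs gs => [//|f fs IH] gs /= [mf Hf Hfs]; exists f; split=> //.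
by rewrite -in_ideal_rcons; apply: IH.
Qed.

(** A regular sequence must end in a proper quotient, which [depth_ge] leaves open; containment in
    the maximal ideal ensures it and survives adjoining each [f]. *)
Lemma depth_regular_seq k gs : (forall p, in_ideal gs p -> mx p) ->
  depth_ge mx k (in_ideal gs) -> exists fs, size fs = k /\ is_regular_seq gs fs.
Proof.
elim: k gs => [|k IH] gs Hgs.
  by exists [::]; split=> // /Hgs; rewrite /in_max_ideal mcoeff1 eqxx => /eqP; rewrite oner_eq0.
case=> f [mf Hf]; rewrite -in_ideal_rcons => /IH [|fs [sz Hfs]].
  rewrite in_ideal_rcons => p [c /Hgs]; rewrite -{2}(subrK (c * f) p).
  by move=> H; apply: (idealD (max_ideal R n)) => //; apply: (idealM (max_ideal R n)).
by exists (f :: fs); split=> /=; [rewrite sz|].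
Qed.

Lemma is_depthP gs d : (forall p, in_ideal gs p -> mx p) ->
  depth_ge mx d (in_ideal gs) -> (forall k, depth_ge mx k (in_ideal gs) -> (k <= d)%N) ->
  is_depth gs d.
Proof.
move=> Hgs Dd Hmax; split; first exact: depth_regular_seq.
by move=> fs /regular_seq_depth; apply: Hmax.
Qed.

Lemma mvarE (i : 'I_n) : mvar R n i = 'X_i.
Proof. by rewrite /mvar valK. Qed.

End Bridge.

Lemma bounded_max (P : nat -> Prop) N : P 0%N -> (forall k, P k -> (k <= N)%N) ->
  exists d, P d /\ forall k, P k -> (k <= d)%N.
Proof.
move=> P0; elim: N => [|N IH] HN; first by exists 0%N.
case: (classic (P N.+1)) => [PN|nPN]; first by exists N.+1.
apply: IH => k Pk; have := HN k Pk; rewrite leq_eqVlt ltnS => /predU1P [E|//].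
by rewrite E in Pk.
Qed.

(** * The filling ideal of a Young diagram *)

Section Young.
Variables (R : fieldType) (lam : seq nat) (w : nat -> nat -> nat).
Hypotheses (part : is_partition lam) (wpos : positive_filling lam w).
Local Notation r := (size lam).
Local Notation c := (head 0%N lam).
Local Notation N := (r + c)%N.

Definition ybox (i : 'I_r) (j : 'I_c) : bool := is_box lam i j.
Definition yfill (i : 'I_r) (j : 'I_c) : nat := w i j.

Lemma is_box_down i j i' j' : is_box lam i j -> (i' <= i)%N -> (j' <= j)%N -> is_box lam i' j'.
Proof.
case/andP => ir jl ii jj; have ir' := leq_ltn_trans ii ir; rewrite /is_box ir' /=.
apply: leq_ltn_trans jj (leq_trans jl _).
have /andP [srt _] := part.
have geq_trans : transitive geq by move=> y x z /= xy yz; apply: leq_trans yz xy.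
by apply: (sorted_leq_nth geq_trans (fun x => leqnn x) 0%N srt).
Qed.

Lemma is_box_ord i j : is_box lam i j -> exists (i' : 'I_r) (j' : 'I_c),
  [/\ i' = i :> nat, j' = j :> nat & ybox i' j'].
Proof.
move=> bij; have /andP [ir jl] := bij.
(* Row lengths do not increase, so column [j] already occurs in row 0. *)
have jc : (j < c)%N by have /andP [_] := is_box_down bij (leq0n i) (leqnn j); rewrite nth0.
by exists (Ordinal ir), (Ordinal jc).
Qed.

Lemma ybox_down (i i' : 'I_r) (j j' : 'I_c) :
  ybox i j -> (i' <= i)%N -> (j' <= j)%N -> ybox i' j'.
Proof. exact: is_box_down. Qed.

Lemma yfill_gt0 i j : ybox i j -> (0 < yfill i j)%N.
Proof. exact: wpos. Qed.

Local Notation fm := (filling_mono ybox yfill).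

Lemma box_lem (i : 'I_r) (j : 'I_c) k (m : 'X_{1..N}) :
  (((U_(lshift c i) + U_(rshift r j)) *+ k <= m) = 
   ((k <= m (lshift c i))%N && (k <= m (rshift r j))%N))%MM.
Proof.
apply/mnm_lepP/andP => [H|[Hi Hj] v].
  have := H (lshift c i); have := H (rshift r j).
  by rewrite !mulmnE !mnmDE !mnm1E !eqxx eq_lrshift eq_rlshift !mul1n.
rewrite mulmnE mnmDE !mnm1E; case: eqP => [<-|_]; first by rewrite eq_rlshift mul1n.
by case: eqP => [<-|_]; rewrite ?mul1n ?mul0n.
Qed.

Lemma mem_IY (g : {mpoly R[nvars lam]}) : g \in IY R lam w <->
  exists (i : 'I_r) (j : 'I_c), ybox i j /\
    g = 'X_[(U_(lshift c i) + U_(rshift r j)) *+ yfill i j].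
Proof.
have E (i : 'I_r) (j : 'I_c) : (xv R lam i * yv R lam j) ^+ w i j =
    'X_[(U_(lshift c i) + U_(rshift r j)) *+ yfill i j].
  by rewrite /xv /yv (mvarE _ (lshift c i)) (mvarE _ (rshift r j)) -mpolyXD mpolyXn.
split.
  case/flatten_mapP => i; rewrite mem_iota /= => ir /mapP [j]; rewrite mem_iota /= => jl ->.
  have [|i' [j' [<- <- bij]]] := @is_box_ord i j; first by rewrite /is_box ir.
  by exists i', j'.
case=> i [j [bij ->]]; have /andP [ir jl] := bij.
apply/flatten_mapP; exists (i : nat); first by rewrite mem_iota.
by apply/mapP; exists (j : nat); [rewrite mem_iota|rewrite E].
Qed.

Lemma IY_mono : in_ideal (IY R lam w) = mono_ideal (fm setT setT).
Proof.
apply: in_ideal_mono; first exact: filling_upset.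
  move=> g /mem_IY [i [j [bij ->]]]; eexists; first by [].
  have := box_lem i j (yfill i j) ((U_(lshift c i) + U_(rshift r j)) *+ yfill i j).
  by rewrite lepm_refl => /esym /andP [Hi Hj]; apply: Or33; exists i, j; rewrite !inE.
move=> m [[i]|[j]|[i [j [_ _ bij Hi Hj]]]]; rewrite ?inE //.
exists ((U_(lshift c i) + U_(rshift r j)) *+ yfill i j)%MM; last by rewrite box_lem Hi.
by apply/mem_IY; exists i, j.
Qed.

Lemma IYx_mono (g : 'I_r) :
  in_ideal (rcons (IY R lam w) (xv R lam g)) = mono_ideal (fm (setT :\ g) setT).
Proof.
rewrite in_ideal_rcons IY_mono /xv (mvarE _ (lshift c g)) adjoin_mono; last exact: filling_upset.
apply: mono_ideal_ext => m; rewrite -(filling_delete_row yfill_gt0 setT m (in_setT g)).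
by rewrite lep1mP -lt0n.
Qed.

Lemma IYy_mono (d : 'I_c) :
  in_ideal (rcons (IY R lam w) (yv R lam d)) = mono_ideal (fm setT (setT :\ d)).
Proof.
rewrite in_ideal_rcons IY_mono /yv (mvarE _ (rshift r d)) adjoin_mono; last exact: filling_upset.
apply: mono_ideal_ext => m; rewrite -(filling_delete_col yfill_gt0 setT m (in_setT d)).
by rewrite lep1mP -lt0n.
Qed.

Lemma filling_proper A B : ~ fm A B 0%MM.
Proof.
case=> [[i _]|[j _]|[i [j [_ _ bij]]]]; rewrite mnm0E //.
by rewrite leqNgt yfill_gt0.
Qed.

Lemma filling_sub_max A B p : mono_ideal (fm A B) p -> @in_max_ideal R N p.
Proof.
by move=> Hp; apply/eqP; apply: contraT => /Hp /filling_proper.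
Qed.

Lemma filling_depth A B : exists d, depth_ge (@in_max_ideal R N) d (mono_ideal (fm A B)) /\
  forall k, depth_ge (@in_max_ideal R N) k (mono_ideal (fm A B)) -> (k <= d)%N.
Proof.
apply: (@bounded_max _ N) => // k; apply: depth_maximal; first exact: filling_upset.
exact: filling_proper.
Qed.

End Young.

Theorem theorem3p5 (R : fieldType) (lam : seq nat) (w : nat -> nat -> nat)
    (g d : nat) :
  is_partition lam ->
  positive_filling lam w ->
  minimal_box lam w g d ->
  exists d1 d2 : nat,
    [/\ is_depth (rcons (IY R lam w) (xv R lam g)) d1,
        is_depth (rcons (IY R lam w) (yv R lam d)) d2 &
        is_depth (IY R lam w) (minn d1 d2)].
Proof.
move=> part wpos [bgd Hmin Hnw].
have [g' [d' [Eg Ed bgd']]] := is_box_ord part bgd; subst g d.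
have [d1 [D1 max1]] := filling_depth R wpos (setT :\ g') setT.
have [d2 [D2 max2]] := filling_depth R wpos setT (setT :\ d').
have gT := in_setT g'; have dT := in_setT d'.
exists d1, d2; split; apply: is_depthP.
- by rewrite IYx_mono //; apply: filling_sub_max.
- by rewrite IYx_mono.
- by move=> k; rewrite IYx_mono //; apply: max1.
- by rewrite IYy_mono //; apply: filling_sub_max.
- by rewrite IYy_mono.
- by move=> k; rewrite IYy_mono //; apply: max2.
- by rewrite IY_mono //; apply: filling_sub_max.
- rewrite IY_mono //; apply: (depth_of_deletions (yfill_gt0 wpos) gT dT bgd').
  + by move=> i j _ _; apply: Hmin.
  + exact: depth_geW (geq_minl _ _) D1.
  + exact: depth_geW (geq_minr _ _) D2.
(* For the upper bound, the corner bounds forced by depth at least [k] pass to each deletion and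
   suffice there for depth at least [k]. *)
move=> k; rewrite IY_mono // => /(depth_necessary (@ybox_down lam part)) Hk.
rewrite leq_min; apply/andP; split.
  apply/max1/(depth_sufficient _ (@ybox_down lam part) (yfill_gt0 wpos)).
  apply: (depth_bound_delete_row (@ybox_down lam part) (yfill_gt0 wpos) gT dT bgd') => // i _ ig.
  apply: Hnw; rewrite ?leqnn ?(ltnW ig) //; last by case=> E; rewrite E ltnn in ig.
  exact: is_box_down bgd (ltnW ig) (leqnn _).
apply/max2/(depth_sufficient _ (@ybox_down lam part) (yfill_gt0 wpos)).
apply: (depth_bound_delete_col (@ybox_down lam part) (yfill_gt0 wpos) gT dT bgd') => // j _ jd.
apply: Hnw; rewrite ?leqnn ?(ltnW jd) //; last by case=> E; rewrite E ltnn in jd.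
exact: is_box_down bgd (leqnn _) (ltnW jd).
Qed.
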